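(* Let $M\ge 1$ be an integer and let $R(x,\frac{d}{dx})=\sum_{m=0}^M r_m(x)\bigl(\frac{d}{dx}\bigr)^m$ be an $M$-th order differential operator whose coefficient functions $r_m$ $(m=0,1,\ldots,M)$ are rational functions. Let $l(x)$ be the least common multiple of the denominators of the $r_m(x)$. Then, for any integer $k_0$, any eigenfunction of $A_{R,L^2_{(k_0)}(\mathbb{R})}$ belongs to $C^M\bigl(\mathbb{R}\setminus (l\cdot r_M)^{-1}(0)\bigr)$, where $(l\cdot r_M)^{-1}(0)$ denotes the set of real zeros of the polynomial $l(x)r_M(x)$.
   Context: For $k_0\in\mathbb{Z}$, $L^2_{(k_0)}(\mathbb{R})$ is the Hilbert space of (a.e.-equivalence classes of) measurable functions $f:\mathbb{R}\to\mathbb{C}$ with $\|f\|_{(k_0)}^2=\int_{-\infty}^{\infty}|f(x)|^2(x^2+1)^{k_0}\,dx<\infty$, with inner product $\langle f,g\rangle_{(k_0)}=\int_{-\infty}^\infty f(x)\overline{g(x)}(x^2+1)^{k_0}\,dx$. An element of this space is said to belong to $C^M(U)$, $U\subset\mathbb{R}$ open, if its restriction to $U$ agrees a.e. with an $M$-times continuously differentiable function on $U$. The operator $\widetilde{A}_{R,L^2_{(k_0)}(\mathbb{R})}$ acts by $f\mapsto R(x,\frac{d}{dx})f$ on the domain $\{f\in C^M(\mathbb{R})\cap L^2_{(k_0)}(\mathbb{R}) : R(x,\frac{d}{dx})f\in L^2_{(k_0)}(\mathbb{R})\}$, and $A_{R,L^2_{(k_0)}(\mathbb{R})}$ is its closure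 with respect to the graph norm (i.e. the operator in $L^2_{(k_0)}(\mathbb{R})$ whose graph is the closure of the graph of $\widetilde{A}_{R,L^2_{(k_0)}(\mathbb{R})}$). *)

(* Defs.v *)
From HB Require Import structures.
From mathcomp Require Import all_boot all_order all_algebra.
From mathcomp Require Import complex.
From mathcomp Require Import all_classical all_reals all_analysis.

Set Implicit Arguments.
Unset Strict Implicit.
Unset Printing Implicit Defensive.

Import Order.TTheory GRing.Theory Num.Theory.
Import numFieldNormedType.Exports.

Local Open Scope classical_set_scope.
Local Open Scope complex_scope.
Local Open Scope ring_scope.

(* The representative [repr r] of a fraction need not be reduced, hence the
   division by the gcd.  Both polynomials are determined by [r] up to one common
   nonzero constant factor. *)
Definition rat_num (F : fieldType) (r : {fraction {poly F}}) : {poly F} :=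
  (frac (repr r)).1 %/ gcdp (frac (repr r)).1 (frac (repr r)).2.

Definition rat_den (F : fieldType) (r : {fraction {poly F}}) : {poly F} :=
  (frac (repr r)).2 %/ gcdp (frac (repr r)).1 (frac (repr r)).2.

Lemma rat_den_neq0 (F : fieldType) (r : {fraction {poly F}}) : rat_den r != 0.
Proof.
have d0 := denom_ratioP (repr r).
by rewrite dvdp_div_eq0 ?d0 ?dvdp_gcdr.
Qed.

Lemma coprimep_rat (F : fieldType) (r : {fraction {poly F}}) :
  coprimep (rat_num r) (rat_den r).
Proof.
by apply: coprimep_div_gcd; rewrite (denom_ratioP (repr r)) orbT.
Qed.

Lemma rat_num_den (F : fieldType) (r : {fraction {poly F}}) :
  r = tofrac (rat_num r) / tofrac (rat_den r).
Proof.
have d0 := denom_ratioP (repr r).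
have e : tofrac (frac (repr r)).2 * r = tofrac (frac (repr r)).1.
  elim/quotP: r d0 => q -> d0; unlock FracField.tofrac.
  rewrite -[LHS]FracField.pi_mul; apply/eqmodP; rewrite /= FracField.equivfE.
  by rewrite /FracField.mulf !numden_Ratio ?mulf_neq0 ?oner_neq0 // !mul1r mulr1.
set g := gcdp (frac (repr r)).1 (frac (repr r)).2.
have g0 : g != 0 by rewrite gcdp_eq0 negb_and d0 orbT.
have en : (frac (repr r)).1 = rat_num r * g by rewrite divpK ?dvdp_gcdl.
have ed : (frac (repr r)).2 = rat_den r * g by rewrite divpK ?dvdp_gcdr.
have gF : tofrac g != 0 :> {fraction {poly F}} by rewrite tofrac_eq0.
have dF : tofrac (rat_den r) != 0 :> {fraction {poly F}}.
  by rewrite tofrac_eq0 rat_den_neq0.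
move: e; rewrite en {1}ed !tofracM mulrAC => /(mulIf gF) <-.
by rewrite mulrC mulKf.
Qed.

(* The value at a pole is 0; poles are finite in number, so this convention has
   no effect up to almost everywhere equality. *)
Definition rat_eval (F : fieldType) (r : {fraction {poly F}}) (x : F) : F :=
  (rat_num r).[x] / (rat_den r).[x].

(* [l] is unique up to a nonzero constant factor. *)
Definition is_lcmp (F : fieldType) (I : finType) (q : I -> {poly F})
    (l : {poly F}) : Prop :=
  (forall i, q i %| l) /\
  (forall l' : {poly F}, (forall i, q i %| l') -> l %| l').

Section L2.
Context {R : realType}.
Implicit Types (f g h : R -> R[i]) (k : int) (U : set R).

Definition ReF f : R -> R := fun x => complex.Re (f x).
Definition ImF f : R -> R := fun x => complex.Im (f x).

Definition ae_eqC f g : Prop := {ae lebesgue_measure, forall x : R, f x = g x}.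

Definition sqnorm k f : \bar R :=
  (\int[lebesgue_measure]_x
     ((ComplexField.Normc.normc (f x)) ^+ 2 * (x ^+ 2 + 1) ^ k)%:E)%E.

(* Elements of the Hilbert space are represented by Borel functions; [L2],
   [belongs_CM], the graphs and [eigenfunction] below are invariant under almost
   everywhere equality. *)
Definition L2 k f : Prop :=
  [/\ measurable_fun setT (ReF f), measurable_fun setT (ImF f)
    & (sqnorm k f < +oo)%E].

Definition derivC (n : nat) f : R -> R[i] :=
  fun x => derive1n n (ReF f) x +i* derive1n n (ImF f) x.

Definition CM_real (M : nat) U (u : R -> R) : Prop :=
  (forall n : nat, (n < M)%N -> forall x, U x -> derivable (derive1n n u) x 1) /\
  (forall n : nat, (n <= M)%N -> forall x, U x -> {for x, continuous (derive1n n u)}).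

(* Used for open [U] only, where the derivatives at points of [U] depend only on
   the restriction of [f] to [U]. *)
Definition CM (M : nat) U f : Prop := CM_real M U (ReF f) /\ CM_real M U (ImF f).

Definition belongs_CM (M : nat) U f : Prop :=
  exists2 g, CM M U g &
    {ae lebesgue_measure, forall x : R, U x -> f x = g x}.

Section Operator.
Variables (M : nat) (r : 'I_M.+1 -> {fraction {poly R[i]}}).

Definition diffop f : R -> R[i] :=
  fun x => \sum_(m < M.+1) rat_eval (r m) x%:C * derivC m f x.

(* Operators in the Hilbert space are given by their graphs. *)
Definition graph_Atilde k f g : Prop :=
  [/\ L2 k f, L2 k g &
    exists h, [/\ CM M setT h, ae_eqC f h & ae_eqC g (diffop h)]].

Definition graph_norm k f g : \bar R := sqrte (sqnorm k f + sqnorm k g)%E.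

Definition graph_A k f g : Prop :=
  [/\ L2 k f, L2 k g &
    forall eps : R, 0 < eps -> exists f' g', graph_Atilde k f' g' /\
      (graph_norm k (fun x => f' x - f x)%R (fun x => g' x - g x)%R
         < eps%:E)%E].

End Operator.

Definition eigenfunction (T : (R -> R[i]) -> (R -> R[i]) -> Prop) f : Prop :=
  ~ ae_eqC f (fun=> 0) /\ exists lambda : R[i], T f (fun x => lambda * f x).

End L2.

(* Main.v *)
Require Import Defs.
From HB Require Import structures.
From mathcomp Require Import all_boot all_order all_algebra.
From mathcomp Require Import complex.
From mathcomp Require Import all_classical all_reals all_analysis.
From mathcomp Require Import measurable_realfun ring lra.

(** Write [p] for l r_M, so that l R = sum_m p_m (d/dx)^m with polynomial
    coefficients and leading coefficient [p]. By definition of the closure, an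
    eigenfunction f is the L^2 limit of C^M functions h for which R h tends to
    lambda f. On a segment [a, b] that contains no zero of [p] the weight is
    bounded below, so in L^1(a, b) the functions h tend to f and
    P h = l (R h - lambda h) tends to 0 ([graph_A_approx]); multiplying by l has
    removed the poles.

    Let I be integration from [a]. Integrating P h by parts M times gives
    I^M (P h) = p h + T h + g, where T is a sum of iterated integrals of polynomial
    multiples of its argument, the same for all h, and g is a polynomial of degree
    < M that carries the boundary values of h at [a] ([iterI_by_parts],
    [iterI_diffop]). Nothing is known about g, but in the limit p f + T f appears as
    an L^1 limit of polynomials of degree < M; these form a finite-dimensional,
    hence closed, subspace ([poly_L1_closed]), so f = (q - T f) / p almost
    everywhere for some polynomial q. The right-hand side is continuous, and T
    gains one derivative, so a bootstrap shows that it is as smooth as desired on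
    ]a, b[ ([local_regularity]). This avoids both the existence theory of linear
    differential equations and any control of the derivatives of the approximants.

    The representatives found on segments with rational end points are finally
    glued together ([glue_CM]). *)

Set Implicit Arguments.
Unset Strict Implicit.
Unset Printing Implicit Defensive.

Import Order.TTheory GRing.Theory Num.Theory.
Import numFieldNormedType.Exports.

Local Open Scope classical_set_scope.
Local Open Scope complex_scope.
Local Open Scope ring_scope.

Local Notation Re := complex.Re.
Local Notation Im := complex.Im.

(** * Functions of class C^k on a set *)

Section Ck.
Context {R : realType}.
Implicit Types (u v : R -> R) (V : set R) (k : nat).

(** Existential in the derivatives, so that closure under sums, products, inverses
    and primitives is a direct induction; [Ck_CM_real] recovers the iterated
    derivatives [derive1n] when [V] is open. *)
Fixpoint Ck k V v : Prop :=
  if k is k'.+1 then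
    exists2 v' : R -> R, (forall x, V x -> is_derive x 1 v (v' x)) & Ck k' V v'
  else forall x, V x -> {for x, continuous v}.

Lemma is_derive1_continuous v (x d : R) :
  is_derive x 1 v d -> {for x, continuous v}.
Proof.
by move=> vd; apply/differentiable_continuous/derivable1_diffP/ex_derive.
Qed.

Lemma is_derive_near V u v (x d : R) : open V -> V x ->
  (forall y, V y -> u y = v y) -> is_derive x 1 u d -> is_derive x 1 v d.
Proof.
move=> oV Vx uv; have nuv : \forall y \near x, u y = v y.
  by near=> y; apply: uv; near: y; exact: open_nbhs_nbhs.
exact: near_eq_is_derive nuv.
Unshelve. all: by end_near. Qed.

Lemma Ck_continuous k V v : Ck k V v -> forall x, V x -> {for x, continuous v}.
Proof. by case: k => [//|k] [v' dv _] x /dv; exact: is_derive1_continuous. Qed.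

Lemma Ck_pred k V v : Ck k.+1 V v -> Ck k V v.
Proof.
elim: k v => [|k IH] v [v' dv cv'].
  by move=> x /dv; exact: is_derive1_continuous.
by exists v' => //; exact: IH.
Qed.

Lemma Ck_subset k V W v : W `<=` V -> Ck k V v -> Ck k W v.
Proof.
move=> WV; elim: k v => [|k IH] v /=; first by move=> cv x /WV; exact: cv.
by move=> [v' dv cv']; exists v'; [move=> x /WV; exact: dv | exact: IH].
Qed.

Lemma Ck_ext k V u v : open V -> (forall x, V x -> u x = v x) ->
  Ck k V u -> Ck k V v.
Proof.
case: k => [|k] oV uv /=.
  move=> cu x Vx; have nuv : \forall y \near x, u y = v y.
    by near=> y; apply: uv; near: y; exact: open_nbhs_nbhs.
  rewrite /prop_for /continuous_at -uv//.
  by apply: cvg_trans (cu x Vx); exact: near_eq_cvg nuv.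
by move=> [u' du cu']; exists u' => // x Vx; exact: is_derive_near oV Vx uv (du x Vx).
Unshelve. all: by end_near. Qed.

Lemma Ck_cst k V (c : R) : Ck k V (fun=> c).
Proof.
elim: k c => [|k IH] c /=; first by move=> x _; exact: cvg_cst.
by exists (fun=> 0) => // x _; exact: is_derive_cst.
Qed.

Lemma CkD k V u v : Ck k V u -> Ck k V v -> Ck k V (fun x => u x + v x).
Proof.
elim: k u v => [|k IH] u v /=.
  by move=> cu cv x Vx; apply: cvgD; [exact: cu | exact: cv].
move=> [u' du cu] [v' dv cv]; exists (fun x => u' x + v' x); last exact: IH.
by move=> x Vx; have := du x Vx; have := dv x Vx => ? ?; exact: is_deriveD.
Qed.

Lemma CkM k V u v : Ck k V u -> Ck k V v -> Ck k V (fun x => u x * v x).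
Proof.
elim: k u v => [|k IH] u v.
  by move=> /= cu cv x Vx; apply: cvgM; [exact: cu | exact: cv].
move=> cku ckv; have [cu cv] := (Ck_pred cku, Ck_pred ckv).
case: cku ckv => u' du cu' [v' dv cv'].
exists (fun x => u x * v' x + u' x * v x); last by apply: CkD; exact: IH.
move=> x Vx; apply: is_derive_eq (is_deriveM (du x Vx) (dv x Vx)) _.
by rewrite /GRing.scale/= (mulrC (u' x)).
Qed.

Lemma CkN k V u : Ck k V u -> Ck k V (fun x => - u x).
Proof.
move=> cu; rewrite (_ : (fun x => _) = fun x => -1 * u x).
  by apply: CkM => //; exact: Ck_cst.
by apply/funext => x; rewrite mulN1r.
Qed.

Lemma CkV k V u : (forall x, V x -> u x != 0) -> Ck k V u ->
  Ck k V (fun x => (u x)^-1).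
Proof.
move=> u0; elim: k => [|k IH].
  by move=> /= cu x Vx; apply: cvgV; [exact: u0 | exact: cu].
move=> cku; have cu := Ck_pred cku; case: cku => u' du cu'.
exists (fun x => - ((u x)^-1 * (u x)^-1 * u' x)).
  move=> x Vx; apply: is_derive_eq (is_deriveV (u0 x Vx) (du x Vx)) _.
  by rewrite /GRing.scale/= mulNr expr2 invfM.
by apply: CkN; apply: CkM => //; apply: CkM; exact: IH.
Qed.

Lemma Ck_horner k V (q : {poly R}) : Ck k V (fun x => q.[x]).
Proof.
elim: k q => [|k IH] q /=; first by move=> x _; exact: continuous_horner.
by exists (fun x => q^`().[x]) => // x _; exact: is_derive_poly.
Qed.

(** Each witness agrees on the open set [V] with the derivative computed by
    [derive1], hence also near every point of [V]. *)
Lemma Ck_CM_real k V v : open V -> Ck k V v -> CM_real k V v.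
Proof.
move=> oV; elim: k v => [|k IH] v.
  by move=> cv; split => [//|n]; rewrite leqn0 => /eqP -> x; exact: cv.
move=> [v' dv cv'].
have dE x : V x -> v' x = derive1 v x.
  by move=> Vx; rewrite derive1E; have := dv x Vx => ?; rewrite derive_val.
have [d c] := IH _ (Ck_ext oV dE cv'); split => -[|n] nk x Vx.
- by have ? := dv x Vx; exact: ex_derive.
- by rewrite derive1Sn; exact: d.
- rewrite derive1n0; exact: (is_derive1_continuous (dv x Vx)).
- by rewrite derive1Sn; exact: c.
Qed.

End Ck.

(** * Real integrals over a segment *)

Section AlmostEverywhere.
Context {R : realType}.
Let mu := @lebesgue_measure R.

Lemma ae_imp (P Q : R -> Prop) : (forall x, P x -> Q x) ->
  {ae mu, forall x, P x} -> {ae mu, forall x, Q x}.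
Proof.
by move=> PQ; apply: filterS => //; exact: (ae_filter_ringOfSetsType mu).
Qed.

Lemma ae_and (P Q : R -> Prop) : {ae mu, forall x, P x} ->
  {ae mu, forall x, Q x} -> {ae mu, forall x, P x /\ Q x}.
Proof. by apply: filterI; exact: (ae_filter_ringOfSetsType mu). Qed.

End AlmostEverywhere.

Section RealIntegral.
Context {R : realType}.
Variables a b : R.
Hypothesis ab : a < b.
Let mu := @lebesgue_measure R.
Implicit Types u v c : R -> R.

Definition intb v := mu.-integrable `[a, b] (EFin \o v).
Definition contab v := {within `[a, b], continuous v}.
Definition rI v x : R := \int[mu]_(t in `[a, x]) v t.
Definition rN v : R := \int[mu]_(t in `[a, b]) `|v t|.

Lemma continuous_contab v : continuous v -> contab v.
Proof. exact: continuous_subspaceT. Qed.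

Lemma contab_intb v : contab v -> intb v.
Proof.
by move=> cv; apply: continuous_compact_integrable => //; exact: segment_compact.
Qed.

Lemma intbD u v : intb u -> intb v -> intb (fun x => u x + v x).
Proof. by move=> iu iv; have := integrableD _ iu iv; apply. Qed.

Lemma intbN u : intb u -> intb (fun x => - u x).
Proof. by move=> iu; have := integrableN iu; apply. Qed.

Lemma intbB u v : intb u -> intb v -> intb (fun x => u x - v x).
Proof. by move=> iu iv; apply: intbD => //; exact: intbN. Qed.

Lemma intb_norm u : intb u -> intb (fun x => `|u x|).
Proof. by move=> iu; apply: integrable_norm. Qed.

Lemma contab_bounded c : contab c ->
  exists2 K, 0 <= K & forall x, x \in `[a, b] -> `|c x| <= K.
Proof.
move=> cc.
have cn : {within `[a, b], continuous (fun x => `|c x|)}.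
  by move=> x; apply: continuous_comp; [exact: cc | exact: norm_continuous].
have [d _ dmax] := EVT_max (ltW ab) cn.
by exists `|c d|.
Qed.

Lemma intbM c v : contab c -> intb v -> intb (fun x => c x * v x).
Proof.
move=> cc iv; have [K K0 cK] := contab_bounded cc.
apply: (@integrableMr _ _ _ mu _ _ c (EFin \o v)) => //.
  exact: subspace_continuous_measurable_fun.
exists K; split; first exact: num_real.
by move=> M KM x /= xab; apply: le_trans (cK _ xab) (ltW KM).
Qed.

Lemma rN_ge0 v : 0 <= rN v.
Proof. exact: Rintegral_ge0. Qed.

Lemma eq_rN u v : (forall x, x \in `[a, b] -> u x = v x) -> rN u = rN v.
Proof. by move=> uv; apply: eq_Rintegral => x; rewrite inE => /uv ->. Qed.

Lemma rND u v : intb u -> intb v -> rN (fun x => u x + v x) <= rN u + rN v.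
Proof.
move=> iu iv; rewrite -RintegralD//; [|exact: intb_norm..].
apply: le_Rintegral => //; first exact/intb_norm/intbD.
  by apply: intbD; exact: intb_norm.
by move=> x _; exact: ler_normD.
Qed.

Lemma rNN u : rN (fun x => - u x) = rN u.
Proof. by apply: eq_Rintegral => x _; rewrite normrN. Qed.

Lemma rNM c : contab c -> exists2 K, 0 <= K &
  forall v, intb v -> rN (fun x => c x * v x) <= K * rN v.
Proof.
move=> cc; have [K K0 cK] := contab_bounded cc; exists K => // v iv.
rewrite -RintegralZl//; last exact: intb_norm.
apply: le_Rintegral => //; first exact/intb_norm/intbM.
  have := @intbM (fun=> K) _ _ (intb_norm iv); apply.
  by apply: continuous_contab => x; exact: cvg_cst.
by move=> x xab; rewrite normrM ler_wpM2r// cK.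
Qed.

Lemma ae_rN u v : intb u -> intb v ->
  {ae mu, forall x, x \in `[a, b] -> u x = v x} -> rN (fun x => u x - v x) = 0.
Proof.
move=> iu iv uv; rewrite /rN /Rintegral.
rewrite (_ : integral _ _ _ = 0%E)//.
have iuv := intbB iu iv.
apply/(@ae_eq_integral_abs _ _ _ mu _ _ (fun x => (u x - v x)%:E)) => //.
  exact: measurable_int iuv.
by apply: ae_imp uv => x uvx /= /uvx ->; rewrite subrr.
Qed.

Lemma rN_eq0 v : intb v -> rN v = 0 ->
  {ae mu, forall x, x \in `[a, b] -> v x = 0}.
Proof.
move=> iv v0; have mv : measurable_fun `[a, b] (EFin \o v) := measurable_int _ iv.
have : (\int[mu]_(x in `[a, b]) `|(EFin \o v) x| = 0)%E.
  rewrite -[LHS]fineK ?[fine _]v0//.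
  exact: integrable_fin_num (intb_norm iv).
move/(ae_eq_integral_abs mu _ mv) => /(_ _)-[]// N [mN N0 sN].
exists N; split=> // x /= nx; apply: sN => /= h; apply: nx => xab.
by have [] := h xab.
Qed.

Lemma intb_sub v x : x \in `[a, b] -> intb v -> mu.-integrable `[a, x] (EFin \o v).
Proof.
rewrite in_itv/= => /andP[ax xb]; apply: integrableS => //.
by apply: subset_itvl; rewrite bnd_simp.
Qed.

Lemma rI_norm v x : x \in `[a, b] -> intb v -> `|rI v x| <= rN v.
Proof.
move=> xab iv; have ivx := intb_sub xab iv.
apply: le_trans (le_normr_Rintegral _ ivx) _ => //.
rewrite -lee_fin !fineK; [|exact: integrable_fin_num (intb_norm iv)|
  exact: integrable_fin_num (intb_sub xab (intb_norm iv))].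
apply: ge0_subset_integral => //.
  exact: measurable_int (intb_norm iv).
by apply: subset_itvl; rewrite bnd_simp; move: xab; rewrite in_itv/= => /andP[].
Qed.

Lemma rID u v x : x \in `[a, b] -> intb u -> intb v ->
  rI (fun t => u t + v t) x = rI u x + rI v x.
Proof. by move=> xab iu iv; apply: RintegralD => //; exact: intb_sub. Qed.

Lemma rIN u x : x \in `[a, b] -> intb u -> rI (fun t => - u t) x = - rI u x.
Proof.
move=> xab iu; rewrite -mulN1r -RintegralZl//; last exact: intb_sub.
by apply: eq_Rintegral => t _; rewrite mulN1r.
Qed.

Lemma eq_rI u v x : x \in `[a, b] -> (forall t, t \in `[a, b] -> u t = v t) ->
  rI u x = rI v x.
Proof.
rewrite in_itv/= => /andP[ax xb] uv; apply: eq_Rintegral => t.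
rewrite inE /= in_itv/= => /andP[at_ tx]; apply: uv.
by rewrite in_itv/= at_ (le_trans tx).
Qed.

Lemma rI_contab v : intb v -> contab (rI v).
Proof. by move=> iv; apply: parameterized_integral_continuous => //; exact: ltW. Qed.

Lemma rN_le_sup v K : contab v -> (forall x, x \in `[a, b] -> `|v x| <= K) ->
  rN v <= (b - a) * K.
Proof.
move=> cv vK; apply: (@le_trans _ _ (\int[mu]_(t in `[a, b]) K)).
  apply: le_Rintegral => //; first exact/intb_norm/contab_intb.
  by apply: contab_intb; apply: continuous_contab => x; exact: cvg_cst.
have lab : lebesgue_measure `[a, b] = (b - a)%:E.
  by rewrite lebesgue_measure_itv/= lte_fin ab -EFinD.
rewrite Rintegral_cst//.
by rewrite [X in fine X]lab mulrC.
Qed.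

Lemma rI_derive v x : x \in `]a, b[ -> intb v -> {for x, continuous v} ->
  is_derive x 1 (rI v) (v x).
Proof.
rewrite in_itv/= => /andP[ax xb] iv cv.
have [d e] := continuous_FTC1_closed xb iv ax cv.
by apply: DeriveDef => //; rewrite -derive1E.
Qed.

Lemma rI_FTC u u' x : x \in `[a, b] -> (forall t : R, is_derive t 1 u (u' t)) ->
  continuous u' -> rI u' x = u x - u a.
Proof.
rewrite in_itv/= => /andP[]; rewrite le_eqVlt => /predU1P[<- _|ax xb] du cu'.
  by rewrite /rI set_itv1 Rintegral_set1 subrr.
rewrite /rI /Rintegral (@continuous_FTC2 _ u' u)//.
- exact: continuous_subspaceT.
- by split=> [t _||]; [have ? := du t; exact: ex_derive|
    exact/cvg_at_right_filter/(is_derive1_continuous (du a))|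
    exact/cvg_at_left_filter/(is_derive1_continuous (du x))].
- by move=> t _; rewrite derive1E; have := du t => ?; rewrite derive_val.
Qed.

End RealIntegral.

(** * Polynomials of bounded degree are closed in L^1 *)

Section PolyClosed.
Context {R : realType}.
Variables a b : R.
Hypothesis ab : a < b.
Let mu := @lebesgue_measure R.
Implicit Types (u v w : R -> R) (q : {poly R}) (M : nat).

(** A nonzero value of [u - v] would persist on a ball, which has positive measure. *)
Lemma ae_eq_continuous u v :
  (forall x, x \in `]a, b[ -> {for x, continuous u}) ->
  (forall x, x \in `]a, b[ -> {for x, continuous v}) ->
  {ae mu, forall x, x \in `]a, b[ -> u x = v x} ->
  forall x, x \in `]a, b[ -> u x = v x.
Proof.
move=> cu cv [N [mN N0 sN]] x xab; apply/eqP/negP => /negP uvx.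
have : \forall y \near x, (y \in `]a, b[) /\ (u y - v y != 0).
  near=> y; split.
    by near: y; exact: near_in_itvoo.
  near: y.
  have cuv : {for x, continuous (fun y => u y - v y)}.
    by apply: cvgB; [exact: cu | exact: cv].
  by apply: (cvgr_neq0 _ cuv); rewrite subr_eq0.
move=> /nbhs_ballP[e /= e0 eN].
have sub : ball x e `<=` N.
  move=> y /eN[yab uvy]; apply: sN => /= /(_ yab) uvE.
  by rewrite uvE subrr eqxx in uvy.
have : (mu (ball x e) <= mu N)%E.
  by apply: le_measure; rewrite ?inE//; exact: measurable_ball.
have -> : mu (ball x e) = (e *+ 2)%:E := lebesgue_measure_ball x (ltW e0).
rewrite N0 lee_fin leNgt.
by rewrite pmulrn_lgt0// e0.
Unshelve. all: by end_near. Qed.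

(** An interval has more points than the polynomial may have roots; the points
    [a + (b - a) / (k + 2)] are distinct and inside. *)
Lemma poly_eq0_itv q : (forall x, x \in `]a, b[ -> q.[x] = 0) -> q = 0.
Proof.
move=> q0; apply/eqP/negP => /negP qn0.
pose g k : R := a + (b - a) / k.+2%:R.
have gi : injective g.
  move=> i j /addrI/mulfI; rewrite gt_eqF ?subr_gt0// => /(_ isT)/invr_inj/eqP.
  by rewrite eqr_nat => /eqP[].
have := @max_poly_roots _ q (map g (iota 0 (size q))) qn0.
rewrite map_inj_uniq ?iota_uniq// size_map size_iota ltnn => /(_ _ isT) h.
suff : false by []; apply: h; apply/allP => x /mapP[k _ ->]; apply/eqP; apply: q0.
have ba : 0 < b - a by rewrite subr_gt0.
rewrite in_itv/= ltrDl divr_gt0//= /g -ltrBrDl ltr_pdivrMr// ltr_pMr//.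
by rewrite ltr1n.
Qed.

Lemma contab_horner q : contab a b (fun x => q.[x]).
Proof. by apply: continuous_contab => x; exact: continuous_horner. Qed.

Definition moments M u : 'rV[R]_M :=
  \row_j \int[mu]_(x in `[a, b]) (x ^+ j * u x).

Definition gram M : 'M[R]_M :=
  \matrix_(i, j) \int[mu]_(x in `[a, b]) (x ^+ j * x ^+ i).

Lemma intb_monomM k u : intb a b u -> intb a b (fun x => x ^+ k * u x).
Proof.
move=> iu; apply: intbM => //.
rewrite (_ : (fun x => _) = fun x => ('X^k : {poly R}).[x]).
  exact: contab_horner.
by apply/funext => x; rewrite hornerXn.
Qed.

Lemma intb_horner q : intb a b (fun x => q.[x]).
Proof. exact/contab_intb/contab_horner. Qed.

Lemma momentsB M u v : intb a b u -> intb a b v ->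
  moments M (fun x => u x - v x) = moments M u - moments M v.
Proof.
move=> iu iv; apply/rowP => j; rewrite !mxE -RintegralB//; try exact: intb_monomM.
by apply: eq_Rintegral => x _; rewrite mulrBr.
Qed.

Lemma Rintegral_rVpolyM M (c : 'rV[R]_M) v : intb a b v ->
  \int[mu]_(x in `[a, b]) ((rVpoly c).[x] * v x) =
  \sum_i (c 0 i * moments M v 0 i).
Proof.
move=> iv.
have -> : \int[mu]_(x in `[a, b]) ((rVpoly c).[x] * v x) =
    \int[mu]_(x in `[a, b]) \sum_(i < M) (c 0 i * (x ^+ i * v x)).
  apply: eq_Rintegral => x _; rewrite (horner_coef_wide _ (size_poly _ _)) mulr_suml.
  by apply: eq_bigr => i _; rewrite coef_rVpoly_ord mulrA.
suff H (s : seq 'I_M) : intb a b (fun x => \sum_(i <- s) (c 0 i * (x ^+ i * v x))) /\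
  \int[mu]_(x in `[a, b]) (\sum_(i <- s) (c 0 i * (x ^+ i * v x))) =
  \sum_(i <- s) (c 0 i * moments M v 0 i).
  by have [_] := H (index_enum _).
elim: s => [|i s [IH1 IH2]].
  split.
    rewrite (_ : (fun x => _) = fun x => (0 : {poly R}).[x]); first exact: intb_horner.
    by apply/funext => x; rewrite big_nil horner0.
  rewrite big_nil -[RHS](mul0r (fine (mu `[a, b]))) -Rintegral_cst//.
  by apply: eq_Rintegral => x _; rewrite big_nil.
have iciv : intb a b (fun x => c 0 i * (x ^+ i * v x)).
  have := @intbM _ _ _ ab (fun=> c 0 i) _ _ (intb_monomM i iv); apply.
  by apply: continuous_contab => x; exact: cvg_cst.
split.
  rewrite (_ : (fun x => _) = fun x => c 0 i * (x ^+ i * v x)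
     + \sum_(i <- s) (c 0 i * (x ^+ i * v x))); first exact: intbD.
  by apply/funext => x; rewrite big_cons.
rewrite big_cons -IH2 mxE -RintegralZl//; last exact: intb_monomM.
rewrite -RintegralD//.
by apply: eq_Rintegral => x _; rewrite big_cons.
Qed.

Lemma intb_monom k : intb a b (fun x => x ^+ k).
Proof.
rewrite (_ : (fun x => _) = fun x => ('X^k : {poly R}).[x]).
  exact: intb_horner.
by apply/funext => x; rewrite hornerXn.
Qed.

Lemma moments_rVpoly M (c : 'rV[R]_M) :
  moments M (fun x => (rVpoly c).[x]) = c *m gram M.
Proof.
apply/rowP => j; rewrite !mxE.
under eq_Rintegral do rewrite mulrC.
rewrite Rintegral_rVpolyM; last exact: intb_monom.
by apply: eq_bigr => i _; rewrite !mxE; under eq_Rintegral do rewrite mulrC.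
Qed.

(** The Gram matrix of the monomials in L^2(a, b) is definite: if [c] is in its
    kernel, the polynomial with coefficients [c] has square integral 0. *)
Lemma gram_unit M : gram M \in unitmx.
Proof.
rewrite -row_free_unit; apply: inj_row_free => c cG.
set q := rVpoly c.
suff : q = 0 by rewrite /q => /(congr1 (@poly_rV _ M)); rewrite rVpolyK linear0.
have iq2 : intb a b (fun x => q.[x] * q.[x]).
  by apply: intbM => //; [exact: contab_horner | exact: intb_horner].
have q20 : \int[mu]_(x in `[a, b]) (q.[x] * q.[x]) = 0.
  rewrite Rintegral_rVpolyM; last exact: intb_horner.
  by rewrite moments_rVpoly cG big1// => i _; rewrite mxE mulr0.
have := rN_eq0 iq2; rewrite /rN.
under eq_Rintegral do rewrite ger0_norm -?expr2 ?sqr_ge0// expr2.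
move=> /(_ q20) h; apply: poly_eq0_itv; apply: ae_eq_continuous.
- by move=> x _; exact: continuous_horner.
- by move=> x _; exact: cvg_cst.
- apply: ae_imp h => x h xab; apply/eqP; have := h (subset_itv_oo_cc xab).
  by move/eqP; rewrite mulf_eq0 orbb.
Qed.

(** The L^2(a, b)-orthogonal projection onto polynomials of degree < M. As it uses
    [u] only through its moments, it is defined and bounded on L^1 as well. *)
Definition polyproj M u : {poly R} := rVpoly (moments M u *m invmx (gram M)).

Lemma polyprojB M u v : intb a b u -> intb a b v ->
  polyproj M (fun x => u x - v x) = polyproj M u - polyproj M v.
Proof. by move=> iu iv; rewrite /polyproj momentsB// mulmxBl linearB. Qed.

Lemma polyproj_id M q : (size q <= M)%N -> polyproj M (fun x => q.[x]) = q.
Proof.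
by move=> sq; rewrite /polyproj -{1}(poly_rV_K sq) moments_rVpoly mulmxK
  ?gram_unit// poly_rV_K.
Qed.

Lemma monom_bounded k : exists K : R, 0 <= K /\
  forall x, x \in `[a, b] -> `|x ^+ k| <= K.
Proof.
have [K K0 h] := contab_bounded ab (@contab_horner 'X^k).
by exists K; split => // x /h; rewrite hornerXn.
Qed.

Lemma moments_bounded M (j : 'I_M) : exists K, 0 <= K /\
  forall u, intb a b u -> `|moments M u 0 j| <= K * rN a b u.
Proof.
have [K K0 h] := rNM ab (@contab_horner 'X^j); exists K; split=> // u iu.
rewrite mxE; apply: le_trans (le_normr_Rintegral _ _) _ => //.
  exact: intb_monomM.
by apply: le_trans (h u iu); rewrite /rN; under [leRHS]eq_Rintegral do rewrite hornerXn.
Qed.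

Lemma rN_polyproj M : exists2 K, 0 <= K &
  forall u, intb a b u -> rN a b (fun x => (polyproj M u).[x]) <= K * rN a b u.
Proof.
have [B hB] := choice (@moments_bounded M).
have [D hD] := choice monom_bounded.
pose K := \sum_(i < M) (\sum_(j < M) B j * `|invmx (gram M) j i|) * D i.
exists ((b - a) * K).
  apply: mulr_ge0; first by rewrite subr_ge0 ltW.
  apply: sumr_ge0 => i _; apply: mulr_ge0; last by have [] := hD i.
  by apply: sumr_ge0 => j _; apply: mulr_ge0 => //; have [] := hB j.
move=> u iu; rewrite -mulrA; apply: rN_le_sup => //; first exact: contab_horner.
move=> x xab; rewrite (horner_coef_wide _ (size_poly _ _)).
apply: le_trans (ler_norm_sum _ _ _) _; rewrite mulr_suml.
apply: ler_sum => i _; rewrite coef_rVpoly_ord normrM mulrAC.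
apply: ler_pM => //; last exact: (hD i).2.
rewrite mxE; apply: le_trans (ler_norm_sum _ _ _) _; rewrite mulr_suml.
by apply: ler_sum => j _; rewrite normrM mulrAC ler_wpM2r// (hB j).2.
Qed.

(** A finite-dimensional subspace is closed. Concretely, the projection [polyproj] is
    L^1-bounded and fixes the approximating polynomials, so the limit is fixed up
    to a null set. *)
Lemma poly_L1_closed M w : intb a b w ->
  (forall e : R, 0 < e -> exists2 q : {poly R}, (size q <= M)%N &
     rN a b (fun x => w x - q.[x]) <= e) ->
  exists2 q : {poly R}, (size q <= M)%N &
     {ae mu, forall x, x \in `[a, b] -> w x = q.[x]}.
Proof.
move=> iw wq; exists (polyproj M w); first exact: size_poly.
have iwP : intb a b (fun x => w x - (polyproj M w).[x]).
  by apply: intbB => //; exact: intb_horner.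
suff : rN a b (fun x => w x - (polyproj M w).[x]) = 0.
  by move/(rN_eq0 iwP); apply: ae_imp => x h /h /eqP; rewrite subr_eq0 => /eqP.
have [K K0 hK] := rN_polyproj M.
apply/eqP; rewrite eq_le rN_ge0 andbT; apply/ler_addgt0Pl => e e0; rewrite addr0.
have K1 : 0 < 1 + K by rewrite ltr_wpDr.
have [q sq wqe] := wq (e / (1 + K)) (divr_gt0 e0 K1).
have iq := intb_horner q; have iwq := intbB iw iq.
apply: (@le_trans _ _ ((1 + K) * rN a b (fun x => w x - q.[x]))); last first.
  by rewrite -ler_pdivlMl// mulrC.
rewrite mulrDl mul1r; apply: le_trans (lerD (lexx _) (hK _ iwq)).
rewrite polyprojB// (polyproj_id sq).
rewrite -[X in _ <= _ + X]rNN; apply: le_trans (rND _ _) => //.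
  rewrite le_eqVlt; apply/orP; left; apply/eqP.
  by apply: eq_rN => x _; rewrite !hornerE; ring.
by apply: intbN; exact: intb_horner.
Qed.

End PolyClosed.

(** * Complex-valued functions of a real variable *)

Section ComplexParts.
Context {R : realType}.
Implicit Types z w : R[i].

Lemma Re_add z w : Re (z + w) = Re z + Re w. Proof. by case: z; case: w. Qed.
Lemma Im_add z w : Im (z + w) = Im z + Im w. Proof. by case: z; case: w. Qed.
Lemma Re_opp z : Re (- z) = - Re z. Proof. by case: z. Qed.
Lemma Im_opp z : Im (- z) = - Im z. Proof. by case: z. Qed.
Lemma Re_mul z w : Re (z * w) = Re z * Re w - Im z * Im w.
Proof. by case: z; case: w. Qed.
Lemma Im_mul z w : Im (z * w) = Re z * Im w + Im z * Re w.
Proof. by case: z; case: w. Qed.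
Lemma Re_inv z : Re z^-1 = Re z / (Re z ^+ 2 + Im z ^+ 2).
Proof. by case: z. Qed.
Lemma Im_inv z : Im z^-1 = - (Im z / (Re z ^+ 2 + Im z ^+ 2)).
Proof. by case: z. Qed.
Lemma complex_ext z w : Re z = Re w -> Im z = Im w -> z = w.
Proof. by case: z => ? ?; case: w => ? ? /= -> ->. Qed.

Lemma Re2Im2_neq0 z : z != 0 -> Re z ^+ 2 + Im z ^+ 2 != 0.
Proof.
case: z => x y; rewrite eq_complex /= negb_and => h.
by rewrite paddr_eq0 ?sqr_ge0// !sqrf_eq0 negb_and.
Qed.

End ComplexParts.

Section ComplexCk.
Context {R : realType}.
Implicit Types (f g : R -> R[i]) (V : set R) (q : {poly R[i]}) (k : nat).

Definition CkC k V f := Ck k V (ReF f) /\ Ck k V (ImF f).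

Definition isderC f (d : R[i]) (x : R) :=
  is_derive x 1 (ReF f) (Re d) /\ is_derive x 1 (ImF f) (Im d).

Definition evalC q : R -> R[i] := fun x => q.[x%:C].

Lemma CkCD k V f g : CkC k V f -> CkC k V g -> CkC k V (fun x => f x + g x).
Proof.
move=> [fr fi] [gr gi]; split; rewrite /ReF /ImF.
  by under eq_fun do rewrite Re_add; exact: CkD.
by under eq_fun do rewrite Im_add; exact: CkD.
Qed.

Lemma CkCN k V f : CkC k V f -> CkC k V (fun x => - f x).
Proof.
move=> [fr fi]; split; rewrite /ReF /ImF.
  by under eq_fun do rewrite Re_opp; exact: CkN.
by under eq_fun do rewrite Im_opp; exact: CkN.
Qed.

Lemma CkCM k V f g : CkC k V f -> CkC k V g -> CkC k V (fun x => f x * g x).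
Proof.
move=> [fr fi] [gr gi]; split; rewrite /ReF /ImF.
  under eq_fun do rewrite Re_mul.
  by apply: CkD; [|apply: CkN]; exact: CkM.
under eq_fun do rewrite Im_mul.
by apply: CkD; exact: CkM.
Qed.

Lemma CkCV k V f : (forall x, V x -> f x != 0) -> CkC k V f ->
  CkC k V (fun x => (f x)^-1).
Proof.
move=> f0 [fr fi].
have fn : Ck k V (fun x => (Re (f x) ^+ 2 + Im (f x) ^+ 2)^-1).
  apply: CkV; first by move=> x /f0; exact: Re2Im2_neq0.
  by under eq_fun do rewrite !expr2; apply: CkD; exact: CkM.
split; rewrite /ReF /ImF.
  by under eq_fun do rewrite Re_inv; exact: CkM.
by under eq_fun do rewrite Im_inv; apply: CkN; exact: CkM.
Qed.

Lemma CkC_subset k V W f : W `<=` V -> CkC k V f -> CkC k W f.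
Proof. by move=> WV [? ?]; split; apply: Ck_subset WV _. Qed.

Lemma CkC_ext k V f g : open V -> (forall x, V x -> f x = g x) ->
  CkC k V f -> CkC k V g.
Proof.
move=> oV fg [fr fi]; split.
  by apply: Ck_ext fr => // x /fg fgx; rewrite /ReF fgx.
by apply: Ck_ext fi => // x /fg fgx; rewrite /ImF fgx.
Qed.

(** Reduces complex polynomials in a real variable to pairs of real ones, derivative
    included. *)
Lemma evalC_parts q : exists r s : {poly R},
  (forall x, evalC q x = r.[x] +i* s.[x]) /\
  (forall x, evalC q^`() x = r^`().[x] +i* s^`().[x]).
Proof.
elim/poly_ind: q => [|q c [r [s [qE dqE]]]].
  by exists 0, 0; split => x; rewrite /evalC ?derivC ?deriv0 !horner0.
exists (r * 'X + (Re c)%:P), (s * 'X + (Im c)%:P); split => x.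
  move: (qE x); rewrite /evalC !hornerE => ->.
  by case: c => c d; apply: complex_ext => /=; ring.
move: (qE x) (dqE x); rewrite /evalC !derivMXaddC !hornerE => -> ->.
by apply: complex_ext => /=; ring.
Qed.

Lemma CkC_evalC k V q : CkC k V (evalC q).
Proof.
have [r [s [qE _]]] := evalC_parts q.
rewrite (_ : evalC q = fun x => r.[x] +i* s.[x]); last exact/funext.
by split; exact: Ck_horner.
Qed.

Lemma isderC_evalC q x : isderC (evalC q) (evalC q^`() x) x.
Proof.
have [r [s [qE ->]]] := evalC_parts q.
rewrite (_ : evalC q = fun x => r.[x] +i* s.[x]); last exact/funext.
by split; exact: is_derive_poly.
Qed.

Lemma isderCM f g df dg x : isderC f df x -> isderC g dg x ->
  isderC (fun x => f x * g x) (df * g x + f x * dg) x.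
Proof.
move=> [fr fi] [gr gi]; split.
  rewrite (_ : ReF _ = ReF f * ReF g - ImF f * ImF g); last first.
    by apply/funext => y; rewrite /ReF Re_mul.
  apply: is_derive_eq (is_deriveB (is_deriveM fr gr) (is_deriveM fi gi)) _.
  by rewrite Re_add !Re_mul /GRing.scale/= /ReF /ImF; ring.
rewrite (_ : ImF _ = ReF f * ImF g + ImF f * ReF g); last first.
  by apply/funext => y; rewrite /ImF Im_mul.
apply: is_derive_eq (is_deriveD (is_deriveM fr gi) (is_deriveM fi gr)) _.
by rewrite Im_add !Im_mul /GRing.scale/= /ReF /ImF; ring.
Qed.

End ComplexCk.

Section ComplexIntegral.
Context {R : realType}.
Variables a b : R.
Hypothesis ab : a < b.
Let mu := @lebesgue_measure R.
Let V : set R := [set x | x \in `]a, b[].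
Implicit Types (f g c : R -> R[i]).

Definition intC f := intb a b (ReF f) /\ intb a b (ImF f).
Definition contC f := contab a b (ReF f) /\ contab a b (ImF f).
Definition Iab f : R -> R[i] := fun x => rI a (ReF f) x +i* rI a (ImF f) x.
(** Sum of the L^1 norms of the two parts: equivalent to the L^1 norm of the modulus,
    and every estimate splits into real ones. *)
Definition Nab f : R := rN a b (ReF f) + rN a b (ImF f).

Lemma contC_intC f : contC f -> intC f.
Proof. by move=> [? ?]; split; exact: contab_intb. Qed.

Lemma CkC_contC f : CkC 0 setT f -> contC f.
Proof. by move=> [fr fi]; split; apply: continuous_contab => x; [exact: fr|exact: fi]. Qed.

Lemma intCD f g : intC f -> intC g -> intC (fun x => f x + g x).
Proof.
move=> [fr fi] [gr gi]; split; rewrite /ReF /ImF.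
  by under eq_fun do rewrite Re_add; exact: intbD.
by under eq_fun do rewrite Im_add; exact: intbD.
Qed.

Lemma intCN f : intC f -> intC (fun x => - f x).
Proof.
move=> [fr fi]; split; rewrite /ReF /ImF.
  by under eq_fun do rewrite Re_opp; exact: intbN.
by under eq_fun do rewrite Im_opp; exact: intbN.
Qed.

Lemma intCB f g : intC f -> intC g -> intC (fun x => f x - g x).
Proof. by move=> fi gi; apply: intCD => //; exact: intCN. Qed.

Lemma intCM c f : contC c -> intC f -> intC (fun x => c x * f x).
Proof.
move=> [cr ci] [fr fi]; split; rewrite /ReF /ImF.
  by under eq_fun do rewrite Re_mul; apply: intbB; exact: intbM.
by under eq_fun do rewrite Im_mul; apply: intbD; exact: intbM.
Qed.

Lemma eq_Nab f g : (forall x, x \in `[a, b] -> f x = g x) -> Nab f = Nab g.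
Proof.
by move=> fg; congr (_ + _); apply: eq_rN => x /fg fgx; rewrite /ReF /ImF fgx.
Qed.

Lemma NabD f g : intC f -> intC g -> Nab (fun x => f x + g x) <= Nab f + Nab g.
Proof.
move=> [fr fi] [gr gi]; rewrite /Nab /ReF /ImF addrACA; apply: lerD.
  by under eq_fun do rewrite Re_add; exact: rND.
by under eq_fun do rewrite Im_add; exact: rND.
Qed.

Lemma NabN f : Nab (fun x => - f x) = Nab f.
Proof.
rewrite /Nab /ReF /ImF; congr (_ + _).
  by under eq_fun do rewrite Re_opp; rewrite rNN.
by under eq_fun do rewrite Im_opp; rewrite rNN.
Qed.

Lemma NabM c : contC c -> exists2 K, 0 <= K &
  forall f, intC f -> Nab (fun x => c x * f x) <= K * Nab f.
Proof.
move=> [cr ci]; have [Kr Kr0 hr] := rNM ab cr; have [Ki Ki0 hi] := rNM ab ci.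
exists (Kr + Ki); first exact: addr_ge0.
move=> f [fr fi]; rewrite /Nab /ReF /ImF.
under eq_fun do rewrite Re_mul; under [X in _ + rN _ _ X]eq_fun do rewrite Im_mul.
apply: le_trans (lerD (rND _ _) (rND _ _)) _; try exact: intbM.
  by apply: intbN; exact: intbM.
rewrite rNN; have := hr _ fr; have := hr _ fi; have := hi _ fr; have := hi _ fi.
by rewrite /ReF /ImF; lra.
Qed.

Lemma ae_Nab f g : intC f -> intC g ->
  {ae mu, forall x, x \in `[a, b] -> f x = g x} -> Nab (fun x => f x - g x) = 0.
Proof.
move=> [fr fi] [gr gi] fg; rewrite /Nab /ReF /ImF.
under eq_fun do rewrite Re_add Re_opp.
under [X in _ + rN _ _ X]eq_fun do rewrite Im_add Im_opp.
by rewrite !ae_rN ?addr0//; apply: ae_imp fg => x fg /fg; rewrite /ReF /ImF => ->.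
Qed.

Lemma IabD f g x : x \in `[a, b] -> intC f -> intC g ->
  Iab (fun t => f t + g t) x = Iab f x + Iab g x.
Proof.
move=> xab [fr fi] [gr gi]; rewrite /Iab /ReF /ImF.
under eq_fun do rewrite Re_add; under [X in _ +i* rI _ X _]eq_fun do rewrite Im_add.
by apply: complex_ext => /=; rewrite (rID (b := b)).
Qed.

Lemma IabN f x : x \in `[a, b] -> intC f -> Iab (fun t => - f t) x = - Iab f x.
Proof.
move=> xab [fr fi]; rewrite /Iab /ReF /ImF.
under eq_fun do rewrite Re_opp; under [X in _ +i* rI _ X _]eq_fun do rewrite Im_opp.
by apply: complex_ext => /=; rewrite (rIN (b := b)).
Qed.

Lemma eq_Iab f g x : x \in `[a, b] -> (forall t, t \in `[a, b] -> f t = g t) ->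
  Iab f x = Iab g x.
Proof.
move=> xab fg; rewrite /Iab; congr (_ +i* _); apply: (eq_rI xab) => t /fg.
  by rewrite /ReF => ->.
by rewrite /ImF => ->.
Qed.

Lemma Iab_norm f x : x \in `[a, b] -> intC f ->
  `|Re (Iab f x)| + `|Im (Iab f x)| <= Nab f.
Proof. by move=> xab [fr fi]; apply: lerD; exact: rI_norm. Qed.

Lemma Iab_contC f : intC f -> contC (Iab f).
Proof. by move=> [fr fi]; split; exact: rI_contab. Qed.

Lemma Iab_intC f : intC f -> intC (Iab f).
Proof. by move=> fi; exact/contC_intC/Iab_contC. Qed.

Lemma Nab_le_sup f K : contC f ->
  (forall x, x \in `[a, b] -> `|Re (f x)| + `|Im (f x)| <= K) ->
  Nab f <= (b - a) * K *+ 2.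
Proof.
move=> [fr fi] fK; rewrite mulr2n; apply: lerD; apply: rN_le_sup => // x /fK.
  by apply: le_trans; rewrite lerDl.
by apply: le_trans; rewrite lerDr.
Qed.

Lemma CkC_Iab k f : intC f -> CkC k V f -> CkC k.+1 V (Iab f).
Proof.
move=> [fr fi] [cr ci]; split.
  exists (ReF f) => // x xV; apply: (rI_derive (b := b)) => //.
  exact: (Ck_continuous cr).
exists (ImF f) => // x xV; apply: (rI_derive (b := b)) => //.
exact: (Ck_continuous ci).
Qed.

Lemma Iab_FTC f f' x : x \in `[a, b] -> (forall t, isderC f (f' t) t) ->
  CkC 0 setT f' -> Iab f' x = f x - f a.
Proof.
move=> xab df [cr ci]; rewrite /Iab.
rewrite (rI_FTC xab (fun t => (df t).1)); last by move=> t; exact: cr.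
rewrite (rI_FTC xab (fun t => (df t).2)); last by move=> t; exact: ci.
by apply: complex_ext; rewrite /= ?Re_add ?Im_add ?Re_opp ?Im_opp.
Qed.

End ComplexIntegral.

(** * Volterra operators and iterated integration by parts *)

Section Smoothing.
Context {R : realType}.
Variables a b : R.
Hypothesis ab : a < b.
Let mu := @lebesgue_measure R.
Let V : set R := [set x | x \in `]a, b[].
Implicit Types (f g : R -> R[i]) (T : (R -> R[i]) -> R -> R[i]).

Local Notation intC := (intC a b).
Local Notation contC := (contC a b).
Local Notation Iab := (Iab a).
Local Notation Nab := (Nab a b).

(** The properties of a sum of iterated integrals of polynomial multiples of the
    argument that matter below. The bound is pointwise rather than in L^1, so that
    [T f] depends only on the almost everywhere class of [f]. *)
Definition smoothing T : Prop :=
  [/\ forall f, intC f -> contC (T f),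
      exists2 K, 0 <= K & forall f g, intC f -> intC g ->
        forall x, x \in `[a, b] ->
        `|Re (T f x - T g x)| + `|Im (T f x - T g x)| <=
          K * Nab (fun t => f t - g t) &
      forall k f, intC f -> CkC k V f -> CkC k.+1 V (T f)].

Lemma contCD f g : contC f -> contC g -> contC (fun x => f x + g x).
Proof.
move=> [fr fi] [gr gi]; split; rewrite /ReF /ImF.
  under eq_fun do rewrite Re_add.
  by move=> x; apply: cvgD; [exact: fr | exact: gr].
under eq_fun do rewrite Im_add.
by move=> x; apply: cvgD; [exact: fi | exact: gi].
Qed.

Lemma contCN f : contC f -> contC (fun x => - f x).
Proof.
move=> [fr fi]; split; rewrite /ReF /ImF.
  by under eq_fun do rewrite Re_opp; move=> x; apply: cvgN; exact: fr.
by under eq_fun do rewrite Im_opp; move=> x; apply: cvgN; exact: fi.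
Qed.

Lemma contC_evalC q : contC (evalC q).
Proof. exact/CkC_contC/CkC_evalC. Qed.

Lemma smoothing0 : smoothing (fun _ _ => 0).
Proof.
split=> [f _||k f _ _].
- by split; apply: continuous_contab => x; exact: cvg_cst.
- exists 0 => // f g _ _ x _; rewrite subr0 mul0r /=.
  by rewrite !normr0 addr0.
- by split; exact: Ck_cst.
Qed.

Lemma smoothingD T1 T2 : smoothing T1 -> smoothing T2 ->
  smoothing (fun f x => T1 f x + T2 f x).
Proof.
move=> [c1 [K1 K10 h1] s1] [c2 [K2 K20 h2] s2]; split=> [f fi||k f fi fk].
- by apply: contCD; [exact: c1 | exact: c2].
- exists (K1 + K2); first exact: addr_ge0.
  move=> f g fi gi x xab.
  have := h1 f g fi gi x xab; have := h2 f g fi gi x xab.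
  rewrite !Re_add !Im_add !Re_opp !Im_opp !Re_add !Im_add.
  move: (Re (T1 f x)) (Re (T1 g x)) (Im (T1 f x)) (Im (T1 g x)).
  move: (Re (T2 f x)) (Re (T2 g x)) (Im (T2 f x)) (Im (T2 g x)).
  move=> r2 r2' i2 i2' r1 r1' i1 i1' H2 H1.
  rewrite mulrDl; apply: le_trans (lerD H1 H2).
  rewrite addrACA; apply: lerD.
    by apply: le_trans (ler_normD _ _); rewrite le_eqVlt; apply/orP; left;
      apply/eqP; congr (`|_|); ring.
  by apply: le_trans (ler_normD _ _); rewrite le_eqVlt; apply/orP; left;
    apply/eqP; congr (`|_|); ring.
- by apply: CkCD; [exact: s1 | exact: s2].
Qed.

Lemma smoothingN T : smoothing T -> smoothing (fun f x => - T f x).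
Proof.
move=> [c [K K0 h] s]; split=> [f fi||k f fi fk].
- exact/contCN/c.
- exists K => // f g fi gi x xab; apply: le_trans (h f g fi gi x xab).
  by rewrite -opprD Re_opp Im_opp !normrN.
- exact/CkCN/s.
Qed.

Lemma smoothingI T : smoothing T -> smoothing (fun f => Iab (T f)).
Proof.
move=> [c [K K0 h] s]; split=> [f fi||k f fi fk].
- exact/(Iab_contC ab)/contC_intC/c.
- exists ((b - a) * K *+ 2).
    by rewrite mulrn_wge0// mulr_ge0// subr_ge0 ltW.
  move=> f g fi gi x xab.
  have Tf := contC_intC (c _ fi); have Tg := contC_intC (c _ gi).
  rewrite -(IabN xab)// -(IabD xab)//; last exact: intCN.
  apply: le_trans (Iab_norm xab _) _; first exact: intCB.
  rewrite mulrnAl -mulrA; apply: (Nab_le_sup ab).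
    by apply: contCD; [exact: c | exact/contCN/c].
  exact: h.
- apply: (CkC_Iab (b := b)); first exact/contC_intC/c.
  by have [sr si] := s k f fi fk; split; exact: Ck_pred.
Qed.

Lemma smoothing_Imul q : smoothing (fun f => Iab (fun x => evalC q x * f x)).
Proof.
have cq := contC_evalC q.
split=> [f fi||k f fi fk].
- exact/(Iab_contC ab)/(intCM ab).
- have [K K0 hK] := NabM ab cq; exists K => // f g fi gi x xab.
  have qf := intCM ab cq fi; have qg := intCM ab cq gi.
  rewrite -(IabN xab)// -(IabD xab)//; last exact: intCN.
  apply: le_trans (Iab_norm xab _) _; first exact: intCB.
  rewrite (@eq_Nab _ _ _ _ (fun t => evalC q t * (f t - g t))); last first.
    by move=> t _; rewrite mulrBr.
  by apply: hK; exact: intCB.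
- apply: (CkC_Iab (b := b)); first exact: (intCM ab).
  by apply: CkCM => //; exact: CkC_evalC.
Qed.

Lemma smoothing_iterI q k :
  smoothing (fun f => iter k.+1 Iab (fun x => evalC q x * f x)).
Proof. by elim: k => [|k IH]; [exact: smoothing_Imul | exact: smoothingI IH]. Qed.

Lemma eq_iterI k f g x : (forall t, t \in `[a, b] -> f t = g t) ->
  x \in `[a, b] -> iter k Iab f x = iter k Iab g x.
Proof.
by move=> fg; elim: k x => [|k IH] x xab; [exact: fg | exact: (eq_Iab xab)].
Qed.

Lemma iterI_intC k f : intC f -> intC (iter k Iab f).
Proof. by move=> fi; elim: k => //= k; exact: Iab_intC. Qed.

Lemma iterID k f g x : intC f -> intC g -> x \in `[a, b] ->
  iter k Iab (fun t => f t + g t) x = iter k Iab f x + iter k Iab g x.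
Proof.
move=> fi gi; elim: k x => [//|k IH] x xab.
by rewrite !iterS (eq_Iab xab IH) (IabD xab)//; exact: iterI_intC.
Qed.

Lemma iterIN k f x : intC f -> x \in `[a, b] ->
  iter k Iab (fun t => - f t) x = - iter k Iab f x.
Proof.
move=> fi; elim: k x => [//|k IH] x xab.
by rewrite !iterS (eq_Iab xab IH) (IabN xab)//; exact: iterI_intC.
Qed.

Lemma Nab_iterI k : exists2 K, 0 <= K &
  forall f, intC f -> Nab (iter k Iab f) <= K * Nab f.
Proof.
elim: k => [|k [K K0 hK]]; first by exists 1 => // f _; rewrite mul1r.
have ba : 0 <= b - a by rewrite subr_ge0 ltW.
exists ((b - a) * K *+ 2); first by rewrite mulrn_wge0// mulr_ge0.
move=> f fi; have fk := iterI_intC k fi.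
apply: le_trans (Nab_le_sup ab (K := Nab (iter k Iab f)) _ _) _ => //.
- exact: Iab_contC.
- by move=> x xab; exact: Iab_norm.
- by rewrite mulrnAl -mulrA lerMn2r//= ler_wpM2l// hK.
Qed.

(** Complex polynomials are kept as two real ones because [poly_L1_closed] is applied
    to the real and imaginary parts separately. *)
Definition polyfun (k : nat) (g : R -> R[i]) : Prop :=
  exists r s : {poly R}, [/\ (size r <= k)%N, (size s <= k)%N &
    forall x, g x = r.[x] +i* s.[x]].

Lemma polyfun0 k : polyfun k (fun=> 0).
Proof. by exists 0, 0; rewrite size_poly0; split => // x; rewrite horner0. Qed.

Lemma polyfunD k f g : polyfun k f -> polyfun k g -> polyfun k (fun x => f x + g x).
Proof.
move=> [r [s [sr ss fE]]] [r' [s' [sr' ss' gE]]]; exists (r + r'), (s + s').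
split=> [||x]; try by apply: leq_trans (size_polyD _ _) _; rewrite geq_max ?sr ?ss.
by rewrite fE gE !hornerD.
Qed.

Lemma polyfunN k f : polyfun k f -> polyfun k (fun x => - f x).
Proof.
move=> [r [s [sr ss fE]]]; exists (- r), (- s); rewrite !size_polyN.
by split=> // x; rewrite fE !hornerN.
Qed.

Lemma polyfunW k l f : (k <= l)%N -> polyfun k f -> polyfun l f.
Proof.
move=> kl [r [s [sr ss fE]]]; exists r, s; split=> //.
  exact: leq_trans kl.
exact: leq_trans kl.
Qed.

Lemma ReF_iterI k f : ReF (iter k Iab f) = iter k (rI a) (ReF f).
Proof. by elim: k => // k IH; rewrite !iterS -IH. Qed.

Lemma ImF_iterI k f : ImF (iter k Iab f) = iter k (rI a) (ImF f).
Proof. by elim: k => // k IH; rewrite !iterS -IH. Qed.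

(** The iterated primitives of a constant at [a] are the Taylor monomials. *)
Lemma iter_rI_cst k (c : R) x : x \in `[a, b] ->
  iter k (rI a) (fun=> c) x = ((c / k`!%:R) *: ('X - a%:P) ^+ k).[x].
Proof.
elim: k x => [|k IH] x xab; first by rewrite expr0 !hornerE /= divr1.
rewrite iterS (eq_rI xab IH).
set F := fun x : R => ((c / k.+1`!%:R) *: ('X - a%:P) ^+ k.+1).[x].
transitivity (F x - F a); last first.
  by rewrite /F !hornerE subrr expr0n mulr0 subr0.
apply: (rI_FTC xab); last by move=> t; exact: continuous_horner.
move=> t; apply: is_derive_eq (is_derive_poly _ _) _.
rewrite derivZ deriv_exp derivXsubC mul1r /= !hornerZ hornerMn !horner_exp.
rewrite !hornerXsubC factS natrM -[_ ^+ k *+ _]mulr_natl.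
have k1 : k.+1%:R != 0 :> R by rewrite pnatr_eq0.
have kf : k`!%:R != 0 :> R by rewrite pnatr_eq0 -lt0n fact_gt0.
by field; rewrite kf nat1r k1.
Qed.

Lemma polyfun_iterI_cst k (c : R[i]) : exists2 g, polyfun k.+1 g &
  forall x, x \in `[a, b] -> iter k Iab (fun=> c) x = g x.
Proof.
pose e (c : R) := (c / k`!%:R) *: ('X - a%:P) ^+ k.
exists (fun x => (e (Re c)).[x] +i* (e (Im c)).[x]).
  exists (e (Re c)), (e (Im c)); split=> //.
    by apply: leq_trans (size_scale_leq _ _) _; rewrite size_exp_XsubC.
  by apply: leq_trans (size_scale_leq _ _) _; rewrite size_exp_XsubC.
move=> x xab; apply: complex_ext.
  by rewrite -[LHS]/(ReF _ x) ReF_iterI; exact: iter_rI_cst.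
by rewrite -[LHS]/(ImF _ x) ImF_iterI; exact: iter_rI_cst.
Qed.

(** Carrying the derivatives as data lets [iterI_by_parts] pass from order m + 1 to
    order m without unfolding iterated derivatives. *)
Definition chain (m : nat) (u : nat -> R -> R[i]) : Prop :=
  (forall j, (j < m)%N -> forall x, isderC (u j) (u j.+1 x) x) /\
  (forall j, (j <= m)%N -> CkC 0 setT (u j)).

(** One integration by parts gives
    I(q u^(m+1)) = q u^(m) - (q u^(m))(a) - I(q' u^(m)); applying the remaining
    integrals turns the boundary value into a polynomial of degree k and leaves two
    terms of lower order, so induction on [m] applies. Only k = m leaves a term
    without any integral, namely [q u]. [T] does not depend on [u]; the
    polynomial [g] does. *)
Lemma iterI_by_parts m k (q : {poly R[i]}) : (m <= k)%N ->
  exists2 T, smoothing T & forall u, chain m u -> exists2 g, polyfun k g &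
    forall x, x \in `[a, b] -> iter k Iab (fun t => evalC q t * u m t) x =
      (if m == k then evalC q x * u 0%N x else 0) + T (u 0%N) x + g x.
Proof.
elim: m k q => [|m IH] k q.
  case: k => [|k] _.
    exists (fun _ _ => 0); first exact: smoothing0.
    move=> u _; exists (fun=> 0); first exact: polyfun0.
    by move=> x _; rewrite eqxx !addr0.
  exists (fun f => iter k.+1 Iab (fun x => evalC q x * f x)).
    exact: smoothing_iterI.
  move=> u _; exists (fun=> 0); first exact: polyfun0.
  by move=> x _; rewrite add0r addr0.
case: k => [//|k]; rewrite ltnS eqSS => mk.
have [T1 sT1 h1] := IH k q mk; have [T2 sT2 h2] := IH k.+1 q^`() (leqW mk).
exists (fun f x => T1 f x + - T2 f x).
  by apply: smoothingD => //; exact: smoothingN.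
move=> u [du cu].
have cu' : chain m u.
  by split=> j jm; [apply: du; exact: leqW | apply: cu; exact: leqW].
have [g1 pg1 e1] := h1 u cu'; have [g2 pg2 e2] := h2 u cu'.
pose c := evalC q a * u m a; have [g3 pg3 e3] := polyfun_iterI_cst k c.
exists (fun x => g1 x + - (g3 x + g2 x)).
  apply: polyfunD; first exact: polyfunW pg1.
  by apply: polyfunN; exact: polyfunD.
move=> x xab.
have C1 : CkC 0 setT (fun t => evalC q^`() t * u m t) by
  apply: CkCM; [exact: CkC_evalC | exact: cu].
have C2 : CkC 0 setT (fun t => evalC q t * u m.+1 t) by
  apply: CkCM; [exact: CkC_evalC | exact: cu].
have C3 : CkC 0 setT (fun t => evalC q t * u m t) by
  apply: CkCM; [exact: CkC_evalC | exact: cu].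
have i1 := contC_intC (CkC_contC a b C1); have i2 := contC_intC (CkC_contC a b C2).
have i3 := contC_intC (CkC_contC a b C3).
have ic : intC (fun=> c).
  by split; apply: contab_intb; apply: continuous_contab => t; exact: cvg_cst.
have parts y : y \in `[a, b] -> Iab (fun t => evalC q t * u m.+1 t) y =
    evalC q y * u m y + - (c + Iab (fun t => evalC q^`() t * u m t) y).
  move=> yab.
  have := @Iab_FTC _ a b (fun t => evalC q t * u m t)
    (fun t => evalC q^`() t * u m t + evalC q t * u m.+1 t) y yab.
  rewrite (IabD yab i1 i2) => h.
  have {}h := h (fun t => isderCM (isderC_evalC q t) (du m (leqnn _) t)) (CkCD C1 C2).
  by rewrite opprD addrA /c -h addrAC subrr add0r.
rewrite iterSr (eq_iterI k parts xab).
have iI1 := Iab_intC ab i1.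
rewrite iterID//; last by apply: intCN; exact: intCD.
rewrite iterIN//; last exact: intCD.
rewrite iterID// e1// e3// -iterSr e2//.
rewrite (_ : (m == k.+1) = false) ?add0r; last by rewrite ltn_eqF.
by case: ifP => _; ring.
Qed.

End Smoothing.

(** * Regularity of weak solutions on a segment *)

Section LocalRegularity.
Context {R : realType}.
Variables a b : R.
Hypothesis ab : a < b.
Let mu := @lebesgue_measure R.
Let V : set R := [set x | x \in `]a, b[].
Implicit Types (f g : R -> R[i]) (T : (R -> R[i]) -> R -> R[i]).

Local Notation intC := (intC a b).
Local Notation contC := (contC a b).
Local Notation Iab := (Iab a).
Local Notation Nab := (Nab a b).
Local Notation smoothing := (smoothing a b).

Lemma CkC_sum k W n (F : 'I_n -> R -> R[i]) : (forall m, CkC k W (F m)) ->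
  CkC k W (fun x => \sum_(m < n) F m x).
Proof.
elim: n F => [|n IH] F cF.
  by under eq_fun do rewrite big_ord0; split; exact: Ck_cst.
under eq_fun do rewrite big_ord_recr; apply: CkCD => //.
by apply: (IH (fun m => F (widen_ord (leqnSn n) m))).
Qed.

Lemma chain_leq m n (u : nat -> R -> R[i]) : (m <= n)%N -> chain n u -> chain m u.
Proof.
by move=> mn [du cu]; split=> j jm; [apply: du|apply: cu]; exact: leq_trans jm mn.
Qed.

(** Summing [iterI_by_parts] over the terms of an operator of order M: only the
    leading one contributes outside [T]. *)
Lemma iterI_diffop M (p : nat -> {poly R[i]}) n : (n <= M.+1)%N ->
  exists2 T, smoothing T & forall u, chain M u -> exists2 g, polyfun M g &
    forall x, x \in `[a, b] ->
      iter M Iab (fun t => \sum_(m < n) evalC (p m) t * u m t) x =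
      (if (M < n)%N then evalC (p M) x * u 0%N x else 0) + T (u 0%N) x + g x.
Proof.
elim: n => [|n IH] nM.
  exists (fun _ _ => 0); first exact: smoothing0.
  move=> u _; have [g pg ge] := polyfun_iterI_cst a b M 0.
  exists (fun=> 0); first exact: polyfun0.
  move=> x xab; rewrite !addr0.
  under [X in iter M _ X]eq_fun do rewrite big_ord0.
  apply: complex_ext; [rewrite -[LHS]/(ReF _ x) ReF_iterI | rewrite -[LHS]/(ImF _ x) ImF_iterI].
    by rewrite (iter_rI_cst M _ xab) mul0r scale0r horner0.
  by rewrite (iter_rI_cst M _ xab) mul0r scale0r horner0.
have [T1 sT1 h1] := IH (ltnW nM); rewrite ltnS in nM.
have [T2 sT2 h2] := iterI_by_parts ab (p n) nM.
exists (fun f x => T1 f x + T2 f x); first exact: smoothingD.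
move=> u chu; have [g1 pg1 e1] := h1 u chu.
have [g2 pg2 e2] := h2 u (chain_leq nM chu).
exists (fun x => g1 x + g2 x); first exact: polyfunD.
move=> x xab; under [X in iter M _ X]eq_fun do rewrite big_ord_recr.
have Ck m : (m <= n)%N -> CkC 0 setT (fun t => evalC (p m) t * u m t).
  move=> mn; apply: CkCM; first exact: CkC_evalC.
  by apply: chu.2; exact: leq_trans mn nM.
have i1 : intC (fun t => \sum_(m < n) evalC (p m) t * u m t).
  apply/contC_intC/CkC_contC/CkC_sum => m; apply: Ck; exact: ltnW.
have i2 : intC (fun t => evalC (p n) t * u n t).
  exact/contC_intC/CkC_contC/Ck.
rewrite (iterID ab _ i1 i2 xab) e1// e2// ltnNge nM /= ltnS add0r.
rewrite (_ : (n == M) = (M <= n)%N); last by rewrite eqn_leq nM.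
case: ifP => [Mn|_]; last by ring.
have -> : n = M by apply/eqP; rewrite eqn_leq nM.
by ring.
Qed.

Lemma contC_inv f : (forall x, x \in `[a, b] -> f x != 0) -> CkC 0 setT f ->
  contC (fun x => (f x)^-1).
Proof.
move=> f0 cf.
have [cr ci] : CkC 0 [set x | x \in `[a, b]] (fun x => (f x)^-1).
  by apply: CkCV => //; apply: CkC_subset cf.
by split; apply: continuous_in_subspaceT => x; rewrite inE; [exact: cr|exact: ci].
Qed.

Lemma contCM f g : contC f -> contC g -> contC (fun x => f x * g x).
Proof.
move=> [fr fi] [gr gi]; split; rewrite /ReF /ImF.
  under eq_fun do rewrite Re_mul; move=> x.
  by apply: cvgB; apply: cvgM; [exact: fr|exact: gr|exact: fi|exact: gi].
under eq_fun do rewrite Im_mul; move=> x.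
by apply: cvgD; apply: cvgM; [exact: fr|exact: gi|exact: fi|exact: gr].
Qed.

Lemma contC_Ck0 f : contC f -> CkC 0 V f.
Proof.
by move=> [fr fi]; split => x xV;
  [case/(continuous_within_itvP _ ab): fr | case/(continuous_within_itvP _ ab): fi];
  move=> h _ _; apply: h.
Qed.

(** Integrating M times, p_M u + T u + g is small in L^1 for the approximants [u], with
    [g] a polynomial of degree < M. Since [T] is L^1-continuous, p_M f + T f is an L^1
    limit of such polynomials, hence almost everywhere a polynomial q, and f equals
    (q - T f) / p_M almost everywhere. As [T] gains one derivative, that
    representative of f is of class C^k for all k by induction. *)
Lemma local_regularity M (p : nat -> {poly R[i]}) f :
  (forall x, x \in `[a, b] -> evalC (p M) x != 0) -> intC f ->
  (forall e : R, 0 < e -> exists u, [/\ chain M u,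
     Nab (fun x => f x - u 0%N x) <= e &
     Nab (fun x => \sum_(m < M.+1) evalC (p m) x * u m x) <= e]) ->
  exists2 g, CkC M V g & {ae mu, forall x, x \in `[a, b] -> f x = g x}.
Proof.
move=> p0 fi approx.
have [T [cT [K2 K20 hT] sT] TE] := iterI_diffop p (leqnn M.+1).
have cp := contC_evalC a b (p M).
pose w x := evalC (p M) x * f x + T f x.
have iTf := contC_intC (cT _ fi).
have iw : intC w by apply: intCD => //; exact: intCM.
have wpoly (e : R) : 0 < e -> exists2 g, polyfun M g & Nab (fun x => w x + g x) <= e.
  move=> e0; have [K1 K10 h1] := NabM ab cp; have [K3 K30 h3] := Nab_iterI ab M.
  have ba : 0 <= b - a by rewrite subr_ge0 ltW.
  pose K := K1 + (b - a) * K2 *+ 2 + K3.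
  have K0 : 0 < 1 + K.
    rewrite ltr_wpDr//; apply: addr_ge0 => //; apply: addr_ge0 => //.
    by rewrite mulrn_wge0// mulr_ge0.
  have [u [chu fu Lu]] := approx _ (divr_gt0 e0 K0).
  have [g pg gE] := TE u chu; exists g => //.
  have iu : intC (u 0%N) by apply/contC_intC/CkC_contC/chu.2.
  have iTu := contC_intC (cT _ iu); have ifu := intCB fi iu.
  have iL : intC (fun x => \sum_(m < M.+1) evalC (p m) x * u m x).
    apply/contC_intC/CkC_contC/CkC_sum => m; apply: CkCM; first exact: CkC_evalC.
    by apply: chu.2; rewrite -ltnS.
  rewrite (@eq_Nab _ _ _ _ (fun x => evalC (p M) x * (f x - u 0%N x) +
     ((T f x - T (u 0%N) x) +
     iter M Iab (fun x => \sum_(m < M.+1) evalC (p m) x * u m x) x))); last first.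
    by move=> x xab; rewrite gE// ltnSn /w; ring.
  apply: le_trans (NabD _ _) _.
  - exact: intCM.
  - by apply: intCD; [exact: intCB | exact: iterI_intC].
  apply: le_trans (lerD (h1 _ ifu) (NabD _ _)) _.
  - exact: intCB.
  - exact: iterI_intC.
  have := Nab_le_sup ab (contCD (cT _ fi) (contCN (cT _ iu))) (hT f (u 0%N) fi iu).
  move=> hTu; have := h3 _ iL.
  set N1 := Nab (fun t => f t - u 0%N t) in hTu fu *.
  set N2 := Nab (fun x => \sum_(m < M.+1) _) in Lu *.
  move=> hI; apply: (@le_trans _ _ (K * (e / (1 + K)))); last first.
    rewrite mulrCA ger_pMr// ler_pdivrMr// mul1r lerDr ler01//.
  have N1K1 : K1 * N1 <= K1 * (e / (1 + K)) by rewrite ler_wpM2l.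
  have N1K2 : (b - a) * (K2 * N1) *+ 2 <= (b - a) * K2 *+ 2 * (e / (1 + K)).
    by rewrite mulrnAl lerMn2r/= -mulrA ler_wpM2l// ler_wpM2l.
  have N2K3 : K3 * N2 <= K3 * (e / (1 + K)) by rewrite ler_wpM2l.
  rewrite (_ : K * _ = K1 * (e / (1 + K)) + ((b - a) * K2 *+ 2 * (e / (1 + K)) +
    K3 * (e / (1 + K)))); last by rewrite {1}/K !mulrDl -addrA.
  apply: lerD => //; apply: lerD.
    exact: le_trans hTu N1K2.
  exact: le_trans hI N2K3.
have [qr _ qrE] : exists2 q : {poly R}, (size q <= M)%N &
    {ae mu, forall x, x \in `[a, b] -> ReF w x = q.[x]}.
  apply: (poly_L1_closed ab iw.1) => e /wpoly[g [r [s [sr ss gE]]] gw].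
  exists (- r); first by rewrite size_polyN.
  apply: le_trans gw; rewrite (@eq_rN _ _ _ _ (ReF (fun x => w x + g x))).
    by rewrite lerDl rN_ge0.
  by move=> x _; rewrite hornerN opprK -[RHS]/(Re (w x + g x)) Re_add gE.
have [qi _ qiE] : exists2 q : {poly R}, (size q <= M)%N &
    {ae mu, forall x, x \in `[a, b] -> ImF w x = q.[x]}.
  apply: (poly_L1_closed ab iw.2) => e /wpoly[g [r [s [sr ss gE]]] gw].
  exists (- s); first by rewrite size_polyN.
  apply: le_trans gw; rewrite (@eq_rN _ _ _ _ (ImF (fun x => w x + g x))).
    by rewrite lerDr rN_ge0.
  by move=> x _; rewrite hornerN opprK -[RHS]/(Im (w x + g x)) Im_add gE.
pose q x : R[i] := qr.[x] +i* qi.[x].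
have Cq k : CkC k setT q by split; exact: Ck_horner.
pose g x := (q x - T f x) * (evalC (p M) x)^-1.
have cg : contC g.
  apply: contCM; last by apply: contC_inv => //; exact: CkC_evalC.
  by apply: contCD; [exact/CkC_contC/Cq | exact/contCN/cT].
have fg : {ae mu, forall x, x \in `[a, b] -> f x = g x}.
  apply: ae_imp (ae_and qrE qiE) => x [hr hi] xab.
  have wq : w x = q x by apply: complex_ext; [exact: hr|exact: hi].
  by rewrite /g -wq /w addrK mulrAC mulfV ?mul1r// p0.
have ig := contC_intC cg.
(* [sT] needs an argument that is smooth everywhere, not almost everywhere *)
have TfTg x : x \in `[a, b] -> T f x = T g x.
  move=> xab; have := hT f g fi ig x xab; rewrite (ae_Nab fi ig fg) mulr0.
  rewrite Re_add Im_add Re_opp Im_opp => h.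
  have : `|Re (T f x) - Re (T g x)| + `|Im (T f x) - Im (T g x)| == 0.
    by rewrite eq_le h addr_ge0.
  by rewrite paddr_eq0// !normr_eq0 !subr_eq0 => /andP[/eqP ? /eqP ?]; exact: complex_ext.
exists g => //.
suff H k : CkC k V g by exact: H.
have oV : open V by exact: interval_open.
elim: k => [|k IH]; first exact: contC_Ck0.
apply: CkCM.
  apply: CkCD; first exact: CkC_subset (Cq _).
  apply: CkCN; apply: CkC_ext oV _ (sT _ _ ig IH) => x xV.
  by rewrite TfTg//; exact: subset_itv_oo_cc xV.
apply: CkCV; last exact: CkC_evalC.
by move=> x xV; apply: p0; exact: subset_itv_oo_cc xV.
Qed.

End LocalRegularity.

(** * From the weighted L^2 norm to the L^1 norm on a segment *)

Section Weight.
Context {R : realType}.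
Implicit Types (f g : R -> R[i]) (k : int).

Lemma weight_gt0 k (x : R) : 0 < (x ^+ 2 + 1) ^ k.
Proof. by apply: exprz_gt0; rewrite ltr_wpDl// sqr_ge0. Qed.

Lemma continuous_weight k : continuous (fun x : R => (x ^+ 2 + 1) ^ k).
Proof.
have H n : continuous (fun x : R => (x ^+ 2 + 1) ^+ n).
  rewrite (_ : (fun x => _) = fun x => (('X ^+ 2 + 1) ^+ n : {poly R}).[x]).
    exact: continuous_horner.
  by apply/funext => x; rewrite !hornerE.
case: k => n; first exact: H.
move=> x; apply: cvgV; last exact: H.
by rewrite expf_neq0// gt_eqF// ltr_wpDl// sqr_ge0.
Qed.

Lemma normc_sqr (z : R[i]) : ComplexField.Normc.normc z ^+ 2 = Re z ^+ 2 + Im z ^+ 2.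
Proof. by case: z => x y /=; rewrite sqr_sqrtr// addr_ge0 ?sqr_ge0. Qed.

Definition sqdens k f (x : R) : R :=
  ComplexField.Normc.normc (f x) ^+ 2 * (x ^+ 2 + 1) ^ k.

Lemma sqdens_ge0 k f x : 0 <= sqdens k f x.
Proof. by apply: mulr_ge0; [exact: sqr_ge0 | exact/ltW/weight_gt0]. Qed.

Lemma sqnorm_ge0 k f : (0 <= sqnorm k f)%E.
Proof. by apply: integral_ge0 => x _; rewrite lee_fin sqdens_ge0. Qed.

Lemma measurable_sqdens k f : measurable_fun setT (ReF f) ->
  measurable_fun setT (ImF f) -> measurable_fun setT (sqdens k f).
Proof.
move=> mr mi; rewrite (_ : sqdens k f = fun x =>
    (ReF f x ^+ 2 + ImF f x ^+ 2) * (x ^+ 2 + 1) ^ k); last first.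
  by apply/funext => x; rewrite /sqdens normc_sqr.
apply: measurable_funM; last by apply: continuous_measurable_fun; exact: continuous_weight.
by apply: measurable_funD; exact: measurable_funX.
Qed.

Lemma sqdens_integrable k f : L2 k f ->
  (@lebesgue_measure R).-integrable setT (EFin \o sqdens k f).
Proof.
move=> [mr mi fin]; apply/integrableP; split.
  by apply/measurable_EFinP; exact: measurable_sqdens.
apply: le_lt_trans fin; rewrite /sqnorm le_eqVlt; apply/orP; left; apply/eqP.
by apply: eq_integral => x _; apply: gee0_abs; rewrite lee_fin; exact: sqdens_ge0.
Qed.

(** Stands in for the Cauchy-Schwarz inequality in comparing the L^1 and L^2 norms. *)
Lemma ler_norm_young (v d : R) : 0 < d -> `|v| <= d + v ^+ 2 / d.
Proof.
move=> d0; rewrite -(ler_pM2r d0) mulrDl divfK ?gt_eqF// -(real_normK (num_real v)).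
by have := sqr_ge0 (`|v| - d); nra.
Qed.

End Weight.

Section L2L1.
Context {R : realType}.
Variables (a b : R) (k : int).
Hypothesis ab : a < b.
Let mu := @lebesgue_measure R.
Implicit Types (f g : R -> R[i]).

(** For k < 0 the weight decays at infinity, but its inverse is continuous and so
    bounded on the compact segment. *)
Lemma inv_weight_bounded : exists2 K : R, 0 <= K &
  forall x, x \in `[a, b] -> 1 <= K * (x ^+ 2 + 1) ^ k.
Proof.
have c : contab a b (fun x : R => ((x ^+ 2 + 1) ^ k)^-1).
  apply: continuous_contab => x; apply: cvgV; last exact: continuous_weight.
  by rewrite gt_eqF// weight_gt0.
have [K K0 hK] := contab_bounded ab c; exists K => // x /hK.
by rewrite ger0_norm ?invr_ge0 ?(ltW (weight_gt0 _ _))// -ler_pdivrMr ?weight_gt0// div1r.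
Qed.

Lemma sqr_le_sqdens : exists2 K : R, 0 <= K & forall f x, x \in `[a, b] ->
  Re (f x) ^+ 2 <= K * sqdens k f x /\ Im (f x) ^+ 2 <= K * sqdens k f x.
Proof.
have [K K0 hK] := inv_weight_bounded; exists K => // f x /hK h.
rewrite /sqdens normc_sqr mulrCA.
split; apply: (@le_trans _ _ (Re (f x) ^+ 2 + Im (f x) ^+ 2)).
- by rewrite lerDl sqr_ge0.
- by rewrite ler_peMr// addr_ge0 ?sqr_ge0.
- by rewrite lerDr sqr_ge0.
- by rewrite ler_peMr// addr_ge0 ?sqr_ge0.
Qed.

Lemma intb_sqdens (c d : R) f : L2 k f -> intb a b (fun x => c + d * sqdens k f x).
Proof.
move=> L2f.
have cc (e : R) : contab a b (fun=> e) by apply: continuous_contab => x; exact: cvg_cst.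
apply: intbD; first exact/contab_intb/cc.
apply: (intbM ab (cc d)).
by apply: integrableS (sqdens_integrable L2f).
Qed.

Lemma intb_dominated (v h : R -> R) : measurable_fun setT v -> intb a b h ->
  (forall x, x \in `[a, b] -> `|v x| <= h x) -> intb a b v.
Proof.
move=> mv ih vh; apply: le_integrable ih => //.
  by apply/measurable_EFinP; apply: measurable_funS mv.
move=> x xab; rewrite /= lee_fin.
by apply: le_trans (vh x xab) _; exact: ler_norm.
Qed.

Lemma L2_intC f : L2 k f -> intC a b f.
Proof.
move=> L2f; have [K K0 hK] := sqr_le_sqdens; case: (L2f) => mr mi _.
by split; apply: (@intb_dominated _ (fun x => 1 + K * sqdens k f x)) => //;
  [exact: intb_sqdens| |exact: intb_sqdens|] => x /(hK f)[hr hi];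
  apply: le_trans (ler_norm_young _ ltr01) _; rewrite divr1 lerD2l.
Qed.

(** Integrate |v| <= d + v^2 / d over [a, b] with d (b - a) = e / 4, for each of the
    two parts. *)
Lemma L2_Nab_small (e : R) : 0 < e -> exists2 eta : R, 0 < eta &
  forall f, measurable_fun setT (ReF f) -> measurable_fun setT (ImF f) ->
    (sqnorm k f < eta%:E)%E -> Nab a b f <= e.
Proof.
move=> e0; have [K K0 hK] := sqr_le_sqdens.
have ba : 0 < b - a by rewrite subr_gt0.
pose d := e / 4 / (b - a); have d0 : 0 < d by rewrite !divr_gt0.
have K1 : 0 < K + 1 by rewrite ltr_wpDl.
exists (e / 4 * d / (K + 1)); first by rewrite divr_gt0// mulr_gt0// divr_gt0.
move=> f mr mi nf; set eta := (X in (_ < X%:E)%E) in nf.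
have L2f : L2 k f by split => //; apply: lt_trans nf _; exact: ltry.
have iS := intb_sqdens 0 1 L2f.
have S_le : \int[mu]_(x in `[a, b]) sqdens k f x <= eta.
  rewrite -lee_fin; apply: le_trans (ltW nf).
  rewrite fineK; last first.
    apply: integrable_fin_num => //.
    by apply: integrableS (sqdens_integrable L2f).
  apply: ge0_subset_integral => //; last by move=> x _; rewrite lee_fin sqdens_ge0.
  by apply/measurable_EFinP; exact: measurable_sqdens.
have key (v : R -> R) : intb a b v ->
    (forall x, x \in `[a, b] -> v x ^+ 2 <= K * sqdens k f x) -> rN a b v <= e / 4 + e / 4.
  move=> iv vS.
  have icS := intb_sqdens d (K / d) L2f.
  apply: (@le_trans _ _ (\int[mu]_(x in `[a, b]) (d + K / d * sqdens k f x))).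
    apply: le_Rintegral => //; first exact: intb_norm.
    move=> x xab; apply: le_trans (ler_norm_young _ d0) _.
    by rewrite lerD2l (mulrAC K) ler_wpM2r ?invr_ge0 ?(ltW d0)// vS.
  have iS' : intb a b (sqdens k f).
    by apply: integrableS (sqdens_integrable L2f).
  have icst : intb a b (fun=> d).
    by apply: contab_intb; apply: continuous_contab => x; exact: cvg_cst.
  have iKS : intb a b (fun x => K / d * sqdens k f x).
    by have := intb_sqdens 0 (K / d) L2f; under eq_fun do rewrite add0r.
  rewrite RintegralD// RintegralZl//.
  have lab : lebesgue_measure `[a, b] = (b - a)%:E.
    by rewrite lebesgue_measure_itv/= lte_fin ab -EFinD.
  rewrite Rintegral_cst// [X in fine X]lab /=.
  apply: lerD; first by rewrite /d divfK// gt_eqF.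
  apply: (@le_trans _ _ (K / d * eta)).
    by rewrite ler_wpM2l// divr_ge0// ltW.
  rewrite (_ : K / d * eta = e / 4 * (K / (K + 1))); last first.
    by rewrite /eta; field; rewrite !gt_eqF.
  by rewrite ger_pMr ?divr_gt0// ler_pdivrMr// mul1r lerDl.
have [fr fi] := L2_intC L2f.
(* one half for each of the two parts *)
have -> : e = (e / 4 + e / 4) + (e / 4 + e / 4) by field.
by apply: lerD; apply: key => // x /(hK f)[].
Qed.

Lemma graph_norm_lt (eps : R) f g : (graph_norm k f g < eps%:E)%E ->
  (sqnorm k f < (eps ^+ 2)%:E)%E /\ (sqnorm k g < (eps ^+ 2)%:E)%E.
Proof.
rewrite /graph_norm => h.
have s0 : (0 <= sqnorm k f + sqnorm k g)%E by rewrite adde_ge0// sqnorm_ge0.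
have {h} : (sqnorm k f + sqnorm k g < (eps ^+ 2)%:E)%E.
  move: s0 h; case: (_ + _)%E => [r| |] //=.
  rewrite !lte_fin lee_fin => r0 re.
  by rewrite -[r]sqr_sqrtr// ltrXn2r// ?sqrtr_ge0// nnegrE ltW//
    (le_lt_trans _ re) ?sqrtr_ge0.
move=> h; split; apply: le_lt_trans h.
  by rewrite leeDl// sqnorm_ge0.
by rewrite leeDr// sqnorm_ge0.
Qed.

End L2L1.

(** * Clearing denominators *)

Section Coefficients.
Context {R : realType}.
Implicit Types (q : {poly R[i]}) (x : R).

(** A nonzero polynomial has finitely many roots. *)
Lemma ae_nonroot q : q != 0 ->
  {ae @lebesgue_measure R, forall x, q.[x%:C] != 0}.
Proof.
move=> q0; have [s qE] := closed_field_poly_normal q.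
pose A := [set Re z | z in [set` s]].
have cA : countable A.
  by apply: finite_set_countable; apply: finite_image; exact: finite_seq.
exists A; split.
- exact: countable_measurable.
- exact: countable_lebesgue_measure0.
- move=> x /= /negP; rewrite negbK => /eqP qx.
  exists x%:C => //=; move: qx; rewrite qE hornerZ => /eqP.
  rewrite mulf_eq0 lead_coef_eq0 (negPf q0) /= -/(root _ _).
  by rewrite (root_prod_XsubC s).
Qed.

Variables (M : nat) (r : 'I_M.+1 -> {fraction {poly R[i]}}) (l : {poly R[i]}).
Hypothesis ldiv : forall m, rat_den (r m) %| l.

(** The coefficient l r_m, which is a polynomial as soon as l is a common multiple
    of the denominators. *)
Definition cleared_coef (m : 'I_M.+1) : {poly R[i]} :=
  (l %/ rat_den (r m)) * rat_num (r m).

Lemma cleared_coefE m x : l.[x%:C] != 0 ->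
  (cleared_coef m).[x%:C] = l.[x%:C] * rat_eval (r m) x%:C.
Proof.
rewrite /cleared_coef /rat_eval -{1 3}(divpK (ldiv m)) !hornerM mulf_eq0 negb_or.
by move=> /andP[_ d0]; rewrite mulrCA mulrAC -!mulrA (mulrC _^-1) mulfV ?mulr1 1?mulrC.
Qed.

Lemma cleared_coef_unique m q : tofrac q = tofrac l * r m -> q = cleared_coef m.
Proof.
rewrite [r m in X in X -> _]rat_num_den => h.
have d0 : tofrac (rat_den (r m)) != 0 :> {fraction {poly R[i]}}.
  by rewrite tofrac_eq0 rat_den_neq0.
apply/eqP; rewrite -tofrac_eq h /cleared_coef -{1}(divpK (ldiv m)) !tofracM.
by apply/eqP; rewrite -mulrA [_ * (_ / _)]mulrCA divff ?mulr1.
Qed.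

End Coefficients.

Section Main.
Context {R : realType}.
Variables (M : nat) (r : 'I_M.+1 -> {fraction {poly R[i]}}) (l : {poly R[i]}).
Hypothesis hM : (1 <= M)%N.
Hypothesis ldiv : forall m, rat_den (r m) %| l.
Implicit Types (f g h : R -> R[i]).

(** The coefficients of the operator l (R - lambda). *)
Definition eigen_coef (lambda : R[i]) (m : nat) : {poly R[i]} :=
  cleared_coef r l (inord m) - (if m == 0%N then lambda *: l else 0).

(** The eigenvalue does not affect the leading coefficient because M > 0. *)
Lemma eigen_coef_lead lambda : eigen_coef lambda M = cleared_coef r l ord_max.
Proof.
rewrite /eigen_coef (_ : (M == 0%N) = false) ?subr0; last by case: M hM.
by congr (cleared_coef _ _ _); apply/val_inj; rewrite /= inordK.
Qed.

Lemma CM_chain h : CM M setT h -> chain M (fun m => Defs.derivC m h).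
Proof.
move=> [[dr cr] [di ci]]; split=> j jM.
  move=> x; split.
    apply: is_derive_eq (derivableP (dr j jM x I)) _.
    by rewrite -derive1E -derive1nS.
  apply: is_derive_eq (derivableP (di j jM x I)) _.
  by rewrite -derive1E -derive1nS.
by split=> x _; [exact: cr | exact: ci].
Qed.

Lemma eigen_coef_diffop lambda h x : l.[x%:C] != 0 ->
  \sum_(m < M.+1) evalC (eigen_coef lambda m) x * Defs.derivC m h x =
  evalC l x * (diffop r h x - lambda * h x).
Proof.
move=> l0; rewrite mulrBr /diffop mulr_sumr.
have -> : evalC l x * (lambda * h x) =
    \sum_(m < M.+1) (if val m == 0%N then evalC l x * (lambda * h x) else 0).
  by rewrite big_ord_recl /= big1 ?addr0.
rewrite -sumrB; apply: eq_bigr => m _.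
rewrite /evalC /eigen_coef hornerD hornerN mulrBl inord_val cleared_coefE// mulrA.
congr (_ - _); first by rewrite -mulrA.
case: m => -[|m] mM /=; last by rewrite horner0 mul0r.
rewrite hornerZ (mulrC lambda); congr (_ * _).
exact: complex_ext.
Qed.

Section OnSegment.
Variables (a b : R).
Hypothesis ab : a < b.

(** The closure of the graph provides C^M functions h with h -> f and
    R h -> lambda f in L^2, hence l (R h - lambda h) -> 0 in L^1(a, b). The operator with
    cleared denominators equals l (R - lambda) off the zeros of l, a null set, which is
    why poles of the coefficients inside (a, b) are harmless. *)
Lemma graph_A_approx k f lambda (e : R) : l != 0 ->
  graph_A r k f (fun x => lambda * f x) -> 0 < e ->
  exists u, [/\ chain M u, Nab a b (fun x => f x - u 0%N x) <= e &
    Nab a b (fun x => \sum_(m < M.+1) evalC (eigen_coef lambda m) x * u m x) <= e].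
Proof.
move=> l0 [L2f L2lf approx] e0.
have [K1 K10 h1] := NabM ab (contC_evalC a b l).
have [K2 K20 h2] := NabM ab (contC_evalC a b (- lambda *: l)).
have K0 : 0 < 1 + (K1 + K2) by rewrite ltr_wpDr// addr_ge0.
set d := e / (1 + (K1 + K2)); have d0 : 0 < d by rewrite divr_gt0.
have [eta eta0 small] := L2_Nab_small k ab d0.
(* the graph norm controls squares, and min(1, eta)^2 <= eta *)
have eps0 : 0 < Num.min 1 eta by rewrite lt_min ltr01.
have [f' [g' [[L2f' L2g' [h [CMh f'h g'h]]] near_]]] := approx _ eps0.
have epseta : (((Num.min 1 eta) ^+ 2)%:E <= eta%:E)%E.
  rewrite lee_fin expr2; apply: (@le_trans _ _ (1 * Num.min 1 eta)).
    by apply: ler_wpM2r; [exact: ltW | rewrite ge_min lexx].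
  by rewrite mul1r ge_min lexx orbT.
have [nf ng] := graph_norm_lt near_.
have measB (u v : R -> R[i]) : L2 k u -> L2 k v ->
    measurable_fun setT (ReF (fun x => u x - v x)) /\
    measurable_fun setT (ImF (fun x => u x - v x)).
  move=> [ur ui _] [vr vi _]; split; rewrite /ReF /ImF.
    by under eq_fun do rewrite Re_add Re_opp; exact: measurable_funB.
  by under eq_fun do rewrite Im_add Im_opp; exact: measurable_funB.
have Nf : Nab a b (fun x => f' x - f x) <= d.
  have [mr mi] := measB _ _ L2f' L2f.
  by apply: small => //; exact: lt_le_trans nf epseta.
have Ng : Nab a b (fun x => g' x - lambda * f x) <= d.
  have [mr mi] := measB _ _ L2g' L2lf.
  by apply: small => //; exact: lt_le_trans ng epseta.
have if_ := L2_intC ab L2f; have ilf := L2_intC ab L2lf.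
have if' := L2_intC ab L2f'; have ig' := L2_intC ab L2g'.
have chh := CM_chain CMh.
have ih m : (m <= M)%N -> intC a b (Defs.derivC m h).
  by move=> mM; apply/contC_intC/CkC_contC/chh.2.
have dE : d <= e by rewrite ler_pdivrMr// ler_pMr// lerDl addr_ge0.
have h0 x : Defs.derivC 0 h x = h x.
  by rewrite /Defs.derivC /derive1n /=; apply: complex_ext.
exists (fun m => Defs.derivC m h); split=> //.
  rewrite (@eq_Nab _ _ _ _ (fun x => (f x - f' x) + (f' x - Defs.derivC 0 h x))).
    apply: le_trans (NabD _ _) _; [exact: intCB|by apply: intCB => //; exact: ih|].
    rewrite (@ae_Nab _ _ _ f' (Defs.derivC 0 h))//; last 2 first.
    - exact: ih.
    - by apply: ae_imp f'h => x -> _; rewrite h0.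
    rewrite addr0; apply: le_trans dE; apply: le_trans Nf.
    rewrite -[leLHS]NabN le_eqVlt; apply/orP; left; apply/eqP.
    by apply: eq_Nab => x _; rewrite opprB.
  by move=> x _; ring.
(* l (R h - lambda h) in terms of the two quantities known to be small *)
pose H x := evalC l x * (g' x - lambda * f x) + evalC (- lambda *: l) x * (f' x - f x).
set G := fun x => _.
have iG : intC a b G.
  apply/contC_intC/CkC_contC/CkC_sum => m; apply: CkCM; first exact: CkC_evalC.
  by apply: chh.2; rewrite -ltnS.
have i1 : intC a b (fun x => evalC l x * (g' x - lambda * f x)).
  by apply: (intCM ab); [exact: contC_evalC | exact: intCB].
have i2 : intC a b (fun x => evalC (- lambda *: l) x * (f' x - f x)).
  by apply: (intCM ab); [exact: contC_evalC | exact: intCB].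
have iH : intC a b H by exact: intCD.
have GH : {ae @lebesgue_measure R, forall x, x \in `[a, b] -> G x = H x}.
  have ael := ae_and (ae_nonroot l0) (ae_and f'h g'h).
  apply: ae_imp ael => x [lx [f'x g'x]] _.
  rewrite /G eigen_coef_diffop// /H f'x g'x /evalC hornerZ; ring.
rewrite (@eq_Nab _ _ _ _ (fun x => H x + (G x - H x))); last by move=> x _; ring.
apply: le_trans (NabD _ _) _ => //; first exact: intCB.
rewrite (ae_Nab iG iH GH) addr0.
apply: le_trans (NabD _ _) _ => //.
apply: le_trans (lerD (h1 _ (intCB ig' ilf)) (h2 _ (intCB if' if_))) _.
apply: (@le_trans _ _ (K1 * d + K2 * d)).
  by apply: lerD; rewrite ler_wpM2l.
by rewrite -mulrDl /d mulrCA ger_pMr// ler_pdivrMr// mul1r lerDr.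
Qed.

Lemma eigenfunction_on_segment k f lambda :
  (forall x, x \in `[a, b] -> evalC (cleared_coef r l ord_max) x != 0) ->
  graph_A r k f (fun x => lambda * f x) ->
  exists2 g, CkC M [set x | x \in `]a, b[] g &
    {ae @lebesgue_measure R, forall x, x \in `[a, b] -> f x = g x}.
Proof.
move=> p0 gf.
(* otherwise the leading coefficient would vanish at [a] *)
have l0 : l != 0.
  apply/negP => /eqP l0; have aab : a \in `[a, b] by rewrite bound_itvE ltW.
  have /negP[] := p0 a aab.
  by rewrite /evalC /cleared_coef l0 div0p mul0r horner0.
apply: (local_regularity ab (p := eigen_coef lambda)).
- by move=> x; rewrite eigen_coef_lead; exact: p0.
- by case: gf => /(L2_intC ab).
- by move=> e e0; exact: graph_A_approx gf e0.
Qed.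

End OnSegment.
End Main.

(** * Gluing local representatives *)

Section Gluing.
Context {R : realType}.

Lemma rat_itv_nbhs (U : set R) x : open U -> U x -> exists s t : rat,
  (x \in `](ratr s : R), ratr t[) /\ (forall y, y \in `[(ratr s : R), ratr t] -> U y).
Proof.
move=> oU Ux; have /nbhs_ballP[e /= e0 eU] : nbhs x U by exact: open_nbhs_nbhs.
have [s xs] : exists s : rat, ratr s \in `](x - e), x[.
  by apply: rat_in_itvoo; rewrite ltrBlDr ltrDl.
have [t xt] : exists t : rat, ratr t \in `]x, (x + e)[.
  by apply: rat_in_itvoo; rewrite ltrDl.
exists s, t; move: xs xt; rewrite !in_itv/= => /andP[s1 s2] /andP[t1 t2].
split=> [|y]; first by rewrite s2 t1.
rewrite in_itv/= => /andP[y1 y2]; apply: eU.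
by rewrite /ball/= ltr_distlC (lt_le_trans s1 y1) (le_lt_trans y2 t2).
Qed.

(** Segments with rational end points cover U, and there are countably many, so the
    exceptional null sets add up to a null set. Two local representatives are
    continuous and almost everywhere equal on an overlap, hence equal there, so
    choosing any one of them at each point gives a well defined C^M function. *)
Lemma glue_CM M (U : set R) (f : R -> R[i]) : open U ->
  (forall a b : R, a < b -> (forall x, x \in `[a, b] -> U x) ->
     exists2 g, CkC M [set x | x \in `]a, b[] g &
       {ae @lebesgue_measure R, forall x, x \in `[a, b] -> f x = g x}) ->
  belongs_CM M U f.
Proof.
move=> oU loc.
pose A (n : nat) : R := ratr (odflt (0, 0) (unpickle n : option (rat * rat))).1.
pose B (n : nat) : R := ratr (odflt (0, 0) (unpickle n : option (rat * rat))).2.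
pose P n := A n < B n /\ forall x, x \in `[A n, B n] -> U x.
have /choice[G hG] : forall n, exists g, P n ->
    CkC M [set x | x \in `](A n), (B n)[] g /\
    {ae @lebesgue_measure R, forall x, x \in `[A n, B n] -> f x = g x}.
  move=> n; have [[AB ABU]|nP] := pselect (P n); last by exists (fun=> 0).
  by have [g ? ?] := loc _ _ AB ABU; exists g.
have /choice[i hi] : forall x, exists n, U x -> P n /\ x \in `](A n), (B n)[.
  move=> x; have [Ux|nU] := pselect (U x); last by exists 0%N.
  have [s [t [xst stU]]] := rat_itv_nbhs oU Ux.
  exists (pickle (s, t)) => _; rewrite /P /A /B pickleK /=.
  split=> //; split=> //; move: xst; rewrite in_itv/= => /andP[]; exact: lt_trans.
pose g x := G (i x) x.
have gG n x : P n -> x \in `](A n), (B n)[ -> g x = G n x.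
  move=> Pn xn; have Ux : U x by apply: (Pn.2); exact: subset_itv_oo_cc xn.
  have [Pi xi] := hi x Ux; rewrite /g.
  have [ci fi] := hG _ Pi; have [cn fn] := hG _ Pn.
  move: (i x) Pi xi ci fi => j Pj xj cj fj.
  pose a := Num.max (A j) (A n); pose b := Num.min (B j) (B n).
  have sub y : y \in `]a, b[ -> (y \in `](A j), (B j)[) /\ (y \in `](A n), (B n)[).
    by rewrite !in_itv/= gt_max lt_min => /andP[/andP[-> ->] /andP[-> ->]].
  have xab : x \in `]a, b[.
    move: xj xn; rewrite !in_itv/= gt_max lt_min.
    by move=> /andP[-> ->] /andP[-> ->].
  have ab : a < b by move: xab; rewrite in_itv/= => /andP[]; exact: lt_trans.
  have eqae : {ae @lebesgue_measure R, forall y, y \in `]a, b[ -> G j y = G n y}.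
    apply: ae_imp (ae_and fj fn) => y [hj hn] /sub[yj yn].
    by rewrite -hj ?hn//; exact: subset_itv_oo_cc.
  apply: complex_ext.
    apply: (ae_eq_continuous (a := a) (b := b) (u := ReF (G j)) (v := ReF (G n))) => //.
    - by move=> y /sub[yj _]; exact: (Ck_continuous cj.1).
    - by move=> y /sub[_ yn]; exact: (Ck_continuous cn.1).
    - by apply: ae_imp eqae => y h /h; rewrite /ReF => ->.
  apply: (ae_eq_continuous (a := a) (b := b) (u := ImF (G j)) (v := ImF (G n))) => //.
  - by move=> y /sub[yj _]; exact: (Ck_continuous cj.2).
  - by move=> y /sub[_ yn]; exact: (Ck_continuous cn.2).
  - by apply: ae_imp eqae => y h /h; rewrite /ImF => ->.
have Cg n : P n -> CM M [set x | x \in `](A n), (B n)[] g.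
  move=> Pn; have [cn _] := hG _ Pn;
  have [cr ci] : CkC M [set x | x \in `](A n), (B n)[] g.
    apply: CkC_ext cn; first exact: interval_open.
    by move=> x xn; rewrite (gG n).
  by split; apply: Ck_CM_real => //; exact: interval_open.
exists g.
  split; split=> n nM x Ux; have [Pi xi] := hi x Ux; have [[dr cr] [di ci]] := Cg _ Pi.
  - exact: dr.
  - exact: cr.
  - exact: di.
  - exact: ci.
have : {ae @lebesgue_measure R, forall x, forall n,
    P n -> x \in `[A n, B n] -> f x = G n x}.
  apply: ae_foralln => n.
  have [Pn|nP] := pselect (P n).
    by have [_ fn] := hG _ Pn; apply: ae_imp fn => x h _.
  by exists set0; split=> // x /= nh; apply: nh.
apply: ae_imp => x h Ux; have [Pi xi] := hi x Ux.
by rewrite /g; apply: h => //; exact: subset_itv_oo_cc xi.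
Qed.

Lemma open_nonroot (p : {poly R[i]}) : open (~` [set x : R | root p x%:C]).
Proof.
have [r [s [pE _]]] := evalC_parts p.
rewrite (_ : ~` _ = [set x : R | (r.[x] != 0)] `|` [set x : R | s.[x] != 0]); last first.
  apply/seteqP; split => x /=.
    move/negP; rewrite /root -[p.[_]]/(evalC p x) pE eq_complex /= negb_and.
    by move=> /orP[]; [left|right].
  move=> h; apply/negP; rewrite /root -[p.[_]]/(evalC p x) pE eq_complex /= negb_and.
  by apply/orP.
apply: openU.
  apply: (@open_comp _ _ (fun x : R => r.[x]) [set y | y != 0]).
    by move=> x _; exact: continuous_horner.
  exact: open_neq.
apply: (@open_comp _ _ (fun x : R => s.[x]) [set y | y != 0]).
  by move=> x _; exact: continuous_horner.
exact: open_neq.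
Qed.

End Gluing.

(** * Interior regularity of eigenfunctions *)

Theorem theorem2p2 (R : realType) (M : nat) (hM : (1 <= M)%N)
    (r : 'I_M.+1 -> {fraction {poly R[i]}}) (hr : r ord_max != 0)
    (l : {poly R[i]}) (hl : is_lcmp (fun m => rat_den (r m)) l)
    (p : {poly R[i]}) (hp : tofrac p = tofrac l * r ord_max)
    (k0 : int) (f : R -> R[i]) (hf : eigenfunction (graph_A r k0) f) :
  belongs_CM M (~` [set x : R | root p x%:C]) f.
Proof.
have [ldiv _] := hl; have [_ [lambda gf]] := hf.
apply: glue_CM; first exact: open_nonroot.
move=> a b ab abU; apply: (eigenfunction_on_segment hM ldiv ab _ gf) => x xab.
by rewrite -(cleared_coef_unique ldiv hp); exact/negP/abU.
Qed.
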